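(* Let $\lambda$ be a Borel probability measure on $\mathcal X$ that is absolutely continuous with respect to $\mu$, let $\mathcal A_1,\dots,\mathcal A_r$ be Borel subsets of $\mathbb R^k$, and let $N=(N_1,\dots,N_r)\in\mathbb Z_{\ge0}^r$. Then $$\lim_{L\to\infty}\lambda\big(\{x\in\mathcal X:\ \#\{j:L^{-n/k}\xi_j(x,L)\in\mathcal A_i\}=N_i\ \forall i\}\big)=\Psi^{(r)}_N(\mathcal A),$$ where $$\Psi^{(r)}_N(\mathcal A)=\mu\big(\{x\in\mathcal X:\#\{j:\xi_j(x,1)\in\mathcal A_i\}=N_i\ \forall i\}\big)=\mu\big(\{\Gamma g\in\mathcal X:\#(\widehat{\mathbb Z}^ng\cap\mathcal C(\mathcal A_i,\mathcal W))=N_i\ \forall i\}\big).$$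
   Context: Fix integers $k\ge1$, $m\ge0$ and set $n=k+m+1$. Let $G=\mathrm{SL}(n,\mathbb R)$, $\Gamma=\mathrm{SL}(n,\mathbb Z)$, $\mathcal X=\Gamma\backslash G$, and let $\mu$ be the unique right-$G$-invariant Borel probability measure on $\mathcal X$. Vectors in $\mathbb R^n$ are row vectors, written $y=(y',y'',y_n)$ with $y'\in\mathbb R^k$, $y''\in\mathbb R^m$, $y_n\in\mathbb R$; $G$ acts on $\mathbb R^n$ from the right. $\widehat{\mathbb Z}^n$ is the set of primitive integer vectors (coordinates with gcd 1); for $x=\Gamma g$ the set $\widehat{\mathbb Z}^ng$ does not depend on the representative $g$. For $s\in\mathbb R^k$ let $U(s)=\begin{pmatrix}1_k&0&0\\0&1_m&0\\-s&0&1\end{pmatrix}$ (middle block absent if $m=0$), so $yU(s)=(y'-y_ns,y'',y_n)$, and $h_s(x)=xU(s)$. Fix a norm $|\cdot|$ on $\mathbb R^k$. Let $\mathcal W\subset\mathbb R^m\times\mathbb R_{>0}$ be a bounded Borel set with non-empty interior and boundary of Lebesgue measure zero. For $\mathcal A\subset\mathbb R^k$ and $\widetilde{\mathcal W}\subset\mathbb R^m\times\mathbb R_{>0}$ put $\mathcal C(\mathcal A,\widetilde{\mathcal W})=\{y\in\mathbb R^n: y'\in y_n\mathcal A,\ (y'',y_n)\in\widetilde{\mathcal W}\}$. Hitting times: for $x=\Gamma g$ and $L>0$, $\xi_1(x,L),\xi_2(x,L),\dots\in\mathbb R^k$ is the list (with multiplicity, possibly finite or empty) of the multiset $\{v'/v_n: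 v=(v',v'',v_n)\in\widehat{\mathbb Z}^ng,\ (v'',v_n)\in L^{-1}\mathcal W\}$, ordered so that $|\xi_1|\le|\xi_2|\le\cdots$ (ties in arbitrary order); thus $\#\{j:\xi_j(x,L)\in\mathcal A\}=\#(\widehat{\mathbb Z}^ng\cap\mathcal C(\mathcal A,L^{-1}\mathcal W))$. These are exactly the times $s$ at which $h_s(x)$ lies in the section $\mathcal H(\mathcal W,L)=\Gamma\backslash\Gamma H\{R(w):w\in L^{-1}\mathcal W\}$ (with $H$ the stabilizer of $(0,\dots,0,1)$ in $G$ and $R(w)=\begin{pmatrix}w_{m+1}^{-(m+1)/k}1_k&0&0\\0&w_{m+1}1_m&0\\0&w'&w_{m+1}\end{pmatrix}$ for $w=(w',w_{m+1})$), counted with the multiplicity of self-intersection. *)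

(* Defs.v *)
From HB Require Import structures.
From mathcomp Require Import all_boot all_order all_algebra.
From mathcomp Require Import all_classical all_reals all_analysis.
Set Implicit Arguments. Unset Strict Implicit. Unset Printing Implicit Defensive.
Import Order.TTheory GRing.Theory Num.Theory.
Import numFieldNormedType.Exports.
Local Open Scope classical_set_scope.
Local Open Scope ring_scope.

Section Defs.
Variable R : realType.

Definition gcd_row d (z : 'rV[int]_d) : int := \big[gcdz/0%Z]_(i < d) z ord0 i.

Definition lattice d (g : 'M[R]_d) : set 'rV[R]_d :=
  [set (map_mx intr z) *m g | z in [set: 'rV[int]_d]].

Definition prim_lattice d (g : 'M[R]_d) : set 'rV[R]_d :=
  [set (map_mx intr z) *m g | z in [set z : 'rV[int]_d | gcd_row z = 1]].

(* ---------- the space X = SL(d,Z)\SL(d,R), realised as unimodular lattices ---------- *)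
(* Gamma g  <-->  Z^d g  (a bijection, since SL(d,Z) is the stabiliser of Z^d) *)
Record Xspace (d : nat) := MkX {
  Xlat : set 'rV[R]_d ;
  Xlat_unimod : exists g : 'M[R]_d, \det g = 1 /\ Xlat = lattice g }.

Lemma Xspace_inhabited d : exists g : 'M[R]_d, \det g = 1 /\ lattice 1%:M = lattice g.
Proof. by exists 1%:M; rewrite det1. Qed.

Definition X0 d : Xspace d := MkX (Xspace_inhabited d).

HB.instance Definition _ d := gen_eqMixin (Xspace d).
HB.instance Definition _ d := gen_choiceMixin (Xspace d).
HB.instance Definition _ d := isPointed.Build (Xspace d) (X0 d).

(* \hat{Z}^d g for x = Gamma g (independent of the representative g) *)
Definition primX d (x : Xspace d) : set 'rV[R]_d :=
  [set v | exists g : 'M[R]_d, [/\ \det g = 1, Xlat x = lattice g & prim_lattice g v]].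

Definition borel_mx p q : set (set 'M[R]_(p, q)) := <<s [set U | open U] >>.

Definition Xpreim d (A : set (Xspace d)) : set 'M[R]_d :=
  [set g | \det g = 1 /\ exists x, A x /\ Xlat x = lattice g].

Definition Xborel d : set (set (Xspace d)) := [set A | borel_mx (Xpreim A)].
Definition X d := g_sigma_algebraType (@Xborel d).

Definition right_SL_invariant d (mu : set (X d) -> \bar R) :=
  forall (h : 'M[R]_d), \det h = 1 -> forall A : set (X d), measurable A ->
    mu [set x : X d | exists y : X d, A y /\ Xlat x = [set v *m h | v in Xlat y]] = mu A.

Definition box d (a b : 'rV[R]_d) : set 'rV[R]_d :=
  [set y | forall i, a ord0 i <= y ord0 i <= b ord0 i].

Definition lebesgue_null d (S : set 'rV[R]_d) :=
  forall e : R, 0 < e -> exists a b : nat -> 'rV[R]_d,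
    [/\ (forall j i, a j ord0 i <= b j ord0 i),
        S `<=` \bigcup_j box (a j) (b j) &
        (\sum_(0 <= j <oo) ((\prod_(i < d) (b j ord0 i - a j ord0 i))%:E) < e%:E)%E].

(* vectors y = (y', y'', y_n) in R^n, n = k + (m+1):
   y' = lsubmx y : 'rV_k,  (y'', y_n) = rsubmx y : 'rV_(m.+1),  y_n = last coordinate *)
Definition ylast k m (y : 'rV[R]_(k + m.+1)) : R := rsubmx y ord0 ord_max.

(* index set of the list xi_j(x,L): primitive v in Z^n g with (v'', v_n) in L^{-1} W *)
Definition hit_index k m (W : set 'rV[R]_(m.+1)) (x : X (k + m.+1)) (L : R)
  : set 'rV[R]_(k + m.+1) :=
  [set v | primX x v /\ W (L *: rsubmx v)].

Definition xi k m (v : 'rV[R]_(k + m.+1)) : 'rV[R]_k := (ylast v)^-1 *: lsubmx v.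

(* the multiset {j : c * xi_j(x,L) in A}, as the set of indexing primitive vectors *)
Definition hit_set k m (W : set 'rV[R]_(m.+1)) (x : X (k + m.+1)) (L c : R)
  (A : set 'rV[R]_k) : set 'rV[R]_(k + m.+1) :=
  [set v | hit_index W x L v /\ A (c *: xi v)].

End Defs.

(* Main.v *)
(* Right multiplication by D_L = diag(L^(-(m+1)/k) 1_k, L 1_(m+1)), which has determinant 1,
   carries the hits of x at scale L to the hits of x D_L at scale 1. If E is the event at
   scale 1, then the event at scale L is {x : x D_L in E}, so the claim is an instance of the
   mixing of the flow (D_L).

   Mixing is proved along an arbitrary ultrafilter: the limit nu(A) of
   mu(A n {x : x D_L in E}) is a measure dominated by mu. The unipotent group U(s) is
   contracted by D_L, so nu is U(s)-invariant, and so are the superlevel sets F of its density,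
   up to null sets. Now g |-> mu(Fg symmetric-difference F) is a subadditive length on SL(n,R),
   continuous along one-parameter subgroups and zero on U(s); the Mautner argument makes it
   vanish on the opposite root subgroups, hence on SL(n,R). An invariant set is null or
   conull: by Fubini, with a measurable section of X in place of a Haar measure on SL(n,R).
   So the density is constant, nu = mu(E) mu. *)
Require Import Defs.
From HB Require Import structures.
From mathcomp Require Import all_boot all_order all_algebra.
From mathcomp Require Import all_classical all_reals all_analysis.
From mathcomp Require Import measurable_realfun.
From mathcomp Require Import ring lra.
Import Order.TTheory GRing.Theory Num.Theory.
Import numFieldNormedType.Exports.
Local Open Scope classical_set_scope.
Local Open Scope ring_scope.
Set Implicit Arguments. Unset Strict Implicit. Unset Printing Implicit Defensive.

(** * Borel sets of matrices *)

(** An ultrafilter serves because along it the bounded correlations converge for all measurable [A]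
    at once, so the limit is finitely additive for free; domination by mu then gives countable
    additivity. To pass to the ordinary limit, one takes an ultrafilter that contains the indices
    where convergence would fail. The flow contracts only one of two opposite horospherical groups,
    so nu is a priori invariant under that one alone; this is what makes the Mautner argument
    necessary. [X] carries a sigma-algebra but no topology. Continuity of translations in measure is
    therefore lifted to SL(n,R) through countably many open charts on which the projection to [X] is
    injective. The same charts give the measurable section. Mixing speaks of mu only. The law [lam]
    enters at the end: its density is nearly constant on thin layers, and mixing holds with each
    layer as the test set. *)

Section MatrixBorel.
Variable R : realType.

(** Entrywise measurability is what polynomial expressions in the entries preserve; [mxent_borel]
    turns it into measurable preimages of Borel sets. *)
Definition mxent d (T : measurableType d) p q (f : T -> 'M[R]_(p, q)) :=
  forall i j, measurable_fun setT (fun t => f t i j).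

(** An open set is the union of the rational boxes inside it, a countable family, and the preimage
    of a box is a finite intersection of preimages of intervals. *)
Lemma mxent_borel d (T : measurableType d) p q (f : T -> 'M[R]_(p, q)) B :
  mxent f -> borel_mx B -> measurable (f @^-1` B).
Proof.
move=> mf; move: B; apply: smallest_sub.
  split => /=.
  - by rewrite preimage_set0.
  - move=> A mA; rewrite setTD preimage_setC; exact: measurableC.
  - move=> F mF; rewrite preimage_bigcup; exact: bigcup_measurable.
move=> U /= oU.
pose Q := ('M[rat]_(p, q) * 'M[rat]_(p, q))%type.
pose bx (z : Q) := [set M : 'M[R]_(p, q) |
  forall i j, ratr (z.1 i j) < M i j < ratr (z.2 i j)].
pose I := [set z : Q | bx z `<=` U].
have -> : f @^-1` U = \bigcup_(z in I) f @^-1` (bx z).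
  apply/seteqP; split => t /=; last by move=> [z Iz] /Iz.
  move=> Uf.
  have /nbhs_ballP[e /= e0 eU] : nbhs (f t) U by exact: open_nbhs_nbhs.
  have /choice[a ha] : forall ij : 'I_p * 'I_q, exists x : rat,
      ratr x \in `](f t ij.1 ij.2 - e), (f t ij.1 ij.2)[.
    by move=> ij; apply: rat_in_itvoo; rewrite ltrBlDr ltrDl.
  have /choice[b hb] : forall ij : 'I_p * 'I_q, exists x : rat,
      ratr x \in `](f t ij.1 ij.2), (f t ij.1 ij.2 + e)[.
    by move=> ij; apply: rat_in_itvoo; rewrite ltrDl.
  exists (\matrix_(i, j) a (i, j), \matrix_(i, j) b (i, j)) => /=.
    move=> M /= hM; apply: eU; split => // i j.
    move: (hM i j) (ha (i, j)) (hb (i, j)).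
    rewrite !mxE !in_itv /= => /andP[h1 h2] /andP[h3 h4] /andP[h5 h6].
    rewrite /ball /= ltr_distlC; apply/andP; split.
      exact: lt_trans h3 h1.
    exact: lt_trans h2 h6.
  move=> i j; rewrite !mxE.
  by move: (ha (i, j)) (hb (i, j)); rewrite !in_itv /= => /andP[_ ->] /andP[-> _].
rewrite bigcup_mkcond; apply: countable_bigcupT_measurable => [|z]; first exact: countableP.
case: ifP => // _.
rewrite (_ : _ @^-1` _ = \bigcap_(ij in [set: 'I_p * 'I_q])
   ((fun t => f t ij.1 ij.2) @^-1` `]ratr (z.1 ij.1 ij.2), ratr (z.2 ij.1 ij.2)[%classic)).
  apply: fin_bigcap_measurable => // ij _.
  by rewrite -[X in measurable X]setTI; apply: mf.
apply/seteqP; split => t /=.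
  by move=> h [i j] _ /=; rewrite in_itv /=.
by move=> h i j; have := h (i, j) Logic.I; rewrite /= in_itv.
Qed.

Lemma mxent_cst d (T : measurableType d) p q (M : 'M[R]_(p, q)) :
  mxent (fun _ : T => M).
Proof. by move=> i j; exact: measurable_cst. Qed.

Lemma mxent_mul d (T : measurableType d) p q r (f : T -> 'M[R]_(p, q))
  (g : T -> 'M[R]_(q, r)) : mxent f -> mxent g -> mxent (fun t => f t *m g t).
Proof.
move=> mf mg i j; under eq_fun do rewrite mxE.
by apply: measurable_sum => k; exact: measurable_funM.
Qed.

Lemma measurable_det d (T : measurableType d) p (f : T -> 'M[R]_p) :
  mxent f -> measurable_fun setT (fun t => \det (f t)).
Proof.
move=> mf; rewrite /determinant; apply: measurable_sum => s.
apply: measurable_funM; first exact: measurable_cst.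
by apply: measurable_prod => i _; exact: mf.
Qed.

Lemma mxent_adj d (T : measurableType d) p (f : T -> 'M[R]_p) :
  mxent f -> mxent (fun t => \adj (f t)).
Proof.
move=> mf i j; under eq_fun do rewrite mxE /cofactor.
apply: measurable_funM; first exact: measurable_cst.
by apply: measurable_det => k l; under eq_fun do rewrite !mxE; exact: mf.
Qed.

(** [borel_mx] is a bare family of sets; here the same family makes a measurable type, so that
    matrices can be the domain of a measurable function. *)
Definition MB p q := g_sigma_algebraType [set U : set 'M[R]_(p, q) | open U].

Lemma mxent_id p q : mxent (fun M : MB p q => (M : 'M[R]_(p, q))).
Proof.
move=> i j; apply: (measurability _ (RGenOpens.measurableE R)) => _ [_ [a [b ->]] <-].
rewrite setTI; apply: sub_sigma_algebra => /=.
by apply: open_comp; [move=> M _; exact: coord_continuous|exact: interval_open].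
Qed.

Lemma borel_mxE p q (B : set 'M[R]_(p, q)) :
  borel_mx B = measurable (B : set (MB p q)).
Proof. by []. Qed.

Lemma borel_preimage p q r s (F : 'M[R]_(p, q) -> 'M[R]_(r, s)) B :
  mxent (F : MB p q -> _) -> borel_mx B -> borel_mx (F @^-1` B).
Proof. by move=> mF bB; rewrite borel_mxE; exact: (@mxent_borel _ (MB p q)). Qed.

Lemma borel_mulr p q r (h : 'M[R]_(q, r)) B :
  borel_mx B -> borel_mx [set g : 'M[R]_(p, q) | B (g *m h)].
Proof.
apply: (@borel_preimage _ _ _ _ (fun g => g *m h)).
by apply: mxent_mul; [exact: mxent_id|exact: mxent_cst].
Qed.

Lemma borel_mull p q r (h : 'M[R]_(r, p)) B :
  borel_mx B -> borel_mx [set g : 'M[R]_(p, q) | B (h *m g)].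
Proof.
apply: (@borel_preimage _ _ _ _ (fun g => h *m g)).
by apply: mxent_mul; [exact: mxent_cst|exact: mxent_id].
Qed.

Lemma borel_det1 d : borel_mx [set g : 'M[R]_d | \det g = 1].
Proof.
rewrite borel_mxE (_ : [set _ | _] = [set: MB d d] `&`
   (fun g : MB d d => \det (g : 'M[R]_d)) @^-1` [set 1]); last by rewrite setTI.
by apply: measurable_det => //; exact: mxent_id.
Qed.

End MatrixBorel.

(** * The action on the space of lattices *)

Section Lattices.
Variables (R : realType) (d : nat).
Implicit Types (g h : 'M[R]_d) (c : 'M[int]_d) (x y : X R d).

Notation intm := (map_mx (intr : int -> R)).

Lemma intm_mul p q r (a : 'M[int]_(p, q)) (b : 'M[int]_(q, r)) :
  intm (a *m b) = intm a *m intm b.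
Proof. exact: map_mxM. Qed.

Lemma det_intm c : \det c = 1 -> \det (intm c) = 1.
Proof. by move=> c1; rewrite det_map_mx c1. Qed.

(** The adjugate is the inverse used throughout: it works over [int] as over [R], and its entries
    are polynomial, hence measurable. *)
Lemma mulmx_adj1 (K : comNzRingType) (a : 'M[K]_d) : \det a = 1 -> a *m \adj a = 1%:M.
Proof. by move=> a1; rewrite mul_mx_adj a1. Qed.

Lemma mul_adj1 (K : comNzRingType) (a : 'M[K]_d) : \det a = 1 -> \adj a *m a = 1%:M.
Proof. by move=> a1; rewrite mul_adj_mx a1. Qed.

Lemma det_adj1 (K : comNzRingType) (a : 'M[K]_d) : \det a = 1 -> \det (\adj a) = 1.
Proof.
by move=> a1; have := congr1 determinant (mul_adj1 a1); rewrite det_mulmx a1 mulr1 det1.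
Qed.

Lemma det_mul1 (K : comNzRingType) (a b : 'M[K]_d) :
  \det a = 1 -> \det b = 1 -> \det (a *m b) = 1.
Proof. by move=> a1 b1; rewrite det_mulmx a1 b1 mulr1. Qed.

Lemma lattice_mull c g : \det c = 1 -> lattice (intm c *m g) = lattice g.
Proof.
move=> c1; apply/seteqP; split => v [z _ <-].
  by exists (z *m c) => //; rewrite intm_mul mulmxA.
exists (z *m \adj c) => //.
by rewrite mulmxA -intm_mul -mulmxA mul_adj1 // mulmx1.
Qed.

(** Each row of [h] is the image of a unit vector, hence an integer combination of rows of [g]; the
    coefficients form [c], and comparing determinants gives [\det c]. *)
Lemma lattice_inj g h : \det g = 1 -> \det h = 1 -> lattice g = lattice h ->
  exists2 c : 'M[int]_d, \det c = 1 & h = intm c *m g.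
Proof.
move=> g1 h1 gh.
have /choice[z hz] : forall i : 'I_d, exists z : 'rV[int]_d, intm z *m g = row i h.
  move=> i; have : lattice g (row i h).
    by rewrite gh; exists (delta_mx 0 i) => //; rewrite map_delta_mx -rowE.
  by move=> [z _ <-]; exists z.
have ch : h = intm (\matrix_i z i) *m g.
  apply/row_matrixP => i; rewrite row_mul -hz; congr (_ *m _).
  by apply/rowP => j; rewrite !mxE.
exists (\matrix_i z i) => //.
have := congr1 determinant ch.
by rewrite h1 det_mulmx g1 mulr1 det_map_mx => e; apply: (@intr_inj R); rewrite -e.
Qed.

Lemma dvdz_gcd_row n (k : int) (z : 'rV[int]_n) :
  (k %| gcd_row z)%Z <-> forall i, (k %| z ord0 i)%Z.
Proof.
rewrite /gcd_row.
have H (r : seq 'I_n) :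
    (k %| \big[gcdz/0%Z]_(i <- r) z ord0 i)%Z = all (fun i => (k %| z ord0 i)%Z) r.
  by elim: r => [|i r IH] /=; rewrite ?big_nil ?dvdz0 // big_cons dvdz_gcd IH.
rewrite H; split; first by move=> /allP kz i; apply: kz; exact: mem_index_enum.
by move=> kz; apply/allP => i _.
Qed.

(** The gcd of [z *m c] divides every entry of [z *m c *m \adj c], which is [z], and so divides
    1. *)
Lemma gcd_row_mulr z c : \det c = 1 -> gcd_row z = 1 -> gcd_row (z *m c) = 1.
Proof.
move=> c1 z1.
have : (gcd_row (z *m c) %| 1%R)%Z.
  rewrite -z1; apply/dvdz_gcd_row => i.
  have zi : z ord0 i = (z *m c *m \adj c) ord0 i by rewrite -mulmxA mulmx_adj1 // mulmx1.
  rewrite {}zi mxE.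
  elim/big_ind: _ => [|a b|j _]; first by rewrite dvdz0.
    exact: rpredD.
  by apply: dvdz_mulr; exact: ((dvdz_gcd_row _ _).1 (dvdzz _) j).
rewrite dvdz1 => /eqP e1.
(* Divisibility leaves the sign open; [gcdz] is never negative. *)
suff : 0 <= gcd_row (z *m c) by move=> /gez0_abs; rewrite e1.
rewrite /gcd_row; case: (index_enum _) => [|i r]; first by rewrite big_nil.
by rewrite big_cons; exact: le0z_nat.
Qed.

Lemma prim_lattice_mull c g :
  \det c = 1 -> prim_lattice (intm c *m g) = prim_lattice g.
Proof.
move=> c1; apply/seteqP; split => v [z /= z1 <-].
  by exists (z *m c) => /=; [exact: gcd_row_mulr|rewrite intm_mul mulmxA].
exists (z *m \adj c) => /=; first by apply: gcd_row_mulr => //; exact: det_adj1.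
by rewrite mulmxA -intm_mul -mulmxA mul_adj1 // mulmx1.
Qed.

Lemma Xlat_inj x y : Xlat x = Xlat y -> x = y.
Proof.
case: x => a pa; case: y => b pb /= ab; case: b / ab pb => pb.
by congr MkX; exact: Prop_irrelevance.
Qed.

(* Outside SL(d,R), [piX] takes the junk value [X0]; hence [act h] is meaningful only for
   [\det h = 1]. *)
Definition piX g : X R d :=
  if pselect (\det g = 1) is left g1
  then MkX (ex_intro _ g (conj g1 erefl)) else X0 R d.

Lemma Xlat_pi g : \det g = 1 -> Xlat (piX g) = lattice g.
Proof. by move=> g1; rewrite /piX; case: pselect. Qed.

Lemma pi_surj x : exists2 g, \det g = 1 & x = piX g.
Proof.
case: x => l /= pl; have [g [g1 lg]] := pl; exists g => //.
by apply: Xlat_inj; rewrite Xlat_pi.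
Qed.

Lemma pi_mull c g : \det c = 1 -> \det g = 1 -> piX (intm c *m g) = piX g.
Proof.
move=> c1 g1; apply: Xlat_inj.
by rewrite !Xlat_pi ?lattice_mull// det_mul1 // det_intm.
Qed.

Lemma pi_inj g h : \det g = 1 -> \det h = 1 -> piX g = piX h ->
  exists2 c : 'M[int]_d, \det c = 1 & h = intm c *m g.
Proof.
move=> g1 h1 gh; apply: lattice_inj => //.
by rewrite -(Xlat_pi g1) -(Xlat_pi h1) gh.
Qed.

Lemma primX_pi g : \det g = 1 -> primX (piX g) = prim_lattice g.
Proof.
move=> g1; apply/seteqP; split => v.
  move=> [h [h1]]; rewrite Xlat_pi // => gh.
  by have [c c1 ->] := lattice_inj g1 h1 gh; rewrite prim_lattice_mull.
by move=> gv; exists g; split; rewrite ?Xlat_pi.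
Qed.

Lemma XpreimE (A : set (X R d)) : Xpreim A = [set g | \det g = 1 /\ A (piX g)].
Proof.
apply/seteqP; split => g /= [g1].
  move=> [x [Ax lx]]; split => //.
  suff -> : piX g = x by [].
  by apply: Xlat_inj; rewrite Xlat_pi.
by move=> Ag; split => //; exists (piX g); rewrite Xlat_pi.
Qed.

(** [Xborel] only generates the sigma-algebra of [X]; it is already closed under complements and
    countable unions, so nothing is added. Complements are taken inside determinant 1, whence
    [borel_det1]. *)
Lemma measurable_XE (A : set (X R d)) :
  measurable A <-> borel_mx [set g | \det g = 1 /\ A (piX g)].
Proof.
rewrite -XpreimE; split; last by move=> bA; apply: sub_sigma_algebra.
move: A; apply: smallest_sub => //; split => /=.
- rewrite /Xborel /= XpreimE (_ : [set _ | _] = set0) ?borel_mxE //.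
  by apply/seteqP; split => // g [].
- move=> A; rewrite /Xborel /= !XpreimE setTD => bA.
  rewrite (_ : [set _ | _] =
      [set g | \det g = 1] `\` [set g | \det g = 1 /\ A (piX g)]).
    rewrite borel_mxE; apply: measurableD => //; exact: (@borel_det1 R d).
  apply/seteqP; split => g /=; first by move=> [g1 nA]; split => // -[].
  by move=> [g1 nA]; split => // Ag; apply: nA.
- move=> F bF; rewrite /Xborel /= XpreimE.
  rewrite (_ : [set _ | _] = \bigcup_i Xpreim (F i)).
    rewrite borel_mxE; apply: bigcup_measurable => i _; exact: bF.
  apply/seteqP; split => g /=.
    by move=> [g1 [i _ Fi]]; exists i => //; rewrite XpreimE.
  by move=> [i _]; rewrite XpreimE => -[g1 Fi]; split => //; exists i.
Qed.

(** The lifts of the image are the translates of [C] by SL(d,Z), a countable union, cut down to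
    determinant 1. *)
Lemma measurable_pi (C : set 'M[R]_d) : borel_mx C ->
  measurable ([set piX g | g in C `&` [set g | \det g = 1]] : set (X R d)).
Proof.
move=> bC; apply/measurable_XE.
rewrite (_ : [set _ | _] = [set g | \det g = 1] `&`
   \bigcup_(c in [set c : 'M[int]_d | \det c = 1]) [set g | C (intm c *m g)]).
  rewrite borel_mxE; apply: measurableI; first exact: (@borel_det1 R d).
  rewrite bigcup_mkcond; apply: countable_bigcupT_measurable => [|c].
    exact: countableP.
  case: ifP => // _; exact: (borel_mull _ bC).
apply/seteqP; split => g /=.
  move=> [g1 [h [Ch h1] hg]]; split => //.
  by have [c c1 hc] := pi_inj g1 h1 (esym hg); exists c => //=; rewrite -hc.
move=> [g1 [c /= c1 Cg]]; split => //; exists (intm c *m g); last exact: pi_mull.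
by split => //=; rewrite det_mul1 // det_intm.
Qed.

Definition act h x : X R d := piX (projT1 (cid2 (pi_surj x)) *m h).

(** Two representatives differ by an integer matrix on the left, which commutes with multiplication
    on the right. *)
Lemma act_pi g h : \det g = 1 -> \det h = 1 -> act h (piX g) = piX (g *m h).
Proof.
move=> g1 h1; rewrite /act; case: cid2 => /= f f1 fg.
by have [c c1 ->] := pi_inj g1 f1 fg; rewrite -mulmxA pi_mull // det_mul1.
Qed.

Lemma act_comp g h x : \det g = 1 -> \det h = 1 -> act h (act g x) = act (g *m h) x.
Proof.
move=> g1 h1; have [f f1 ->] := pi_surj x.
by rewrite !act_pi ?mulmxA // det_mul1.
Qed.

Lemma act1 x : act 1%:M x = x.
Proof. by have [f f1 ->] := pi_surj x; rewrite act_pi ?det1 ?mulmx1. Qed.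

Lemma act_adjK h x : \det h = 1 -> act (\adj h) (act h x) = x.
Proof. by move=> h1; rewrite act_comp ?det_adj1 // mulmx_adj1 // act1. Qed.

Lemma act_Kadj h x : \det h = 1 -> act h (act (\adj h) x) = x.
Proof. by move=> h1; rewrite act_comp ?det_adj1 // mul_adj1 // act1. Qed.

Lemma act_trans x y : exists2 h, \det h = 1 & act h x = y.
Proof.
have [f f1 ->] := pi_surj x; have [g g1 ->] := pi_surj y.
exists (\adj f *m g); first by rewrite det_mul1 ?det_adj1.
by rewrite act_pi ?det_mul1 ?det_adj1 // mulmxA mulmx_adj1 // mul1mx.
Qed.

Lemma Xlat_act h x : \det h = 1 -> Xlat (act h x) = [set v *m h | v in Xlat x].
Proof.
move=> h1; have [g g1 ->] := pi_surj x.
rewrite act_pi // !Xlat_pi ?det_mul1 //.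
apply/seteqP; split => v /=.
  by move=> [z _ <-]; exists (intm z *m g); [exists z|rewrite mulmxA].
by move=> [w [z _ <-] <-]; exists z => //; rewrite mulmxA.
Qed.

Lemma measurable_act h (A : set (X R d)) : \det h = 1 ->
  measurable A -> measurable (act h @^-1` A).
Proof.
move=> h1 /measurable_XE mA; apply/measurable_XE.
rewrite (_ : [set _ | _] =
   [set g | [set f | \det f = 1 /\ A (piX f)] (g *m h)]).
  exact: borel_mulr.
apply/seteqP; split => g /=.
  by move=> [g1]; rewrite act_pi // => Ag; split => //; rewrite det_mul1.
by rewrite det_mulmx h1 mulr1 => -[g1 Ag]; split => //; rewrite act_pi.
Qed.

(** [right_SL_invariant] speaks of images under right multiplication; the preimage under [act h] is
    the image under [\adj h]. *)
Lemma mu_act (mu : probability (X R d) R) h (A : set (X R d)) :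
  right_SL_invariant mu -> \det h = 1 -> measurable A ->
  mu (act h @^-1` A) = mu A.
Proof.
move=> hmu h1 mA; have h1' := det_adj1 h1.
rewrite -(hmu _ h1' _ mA); congr (mu _); apply/seteqP; split => x /=.
  move=> Ax; exists (act h x); split => //.
  by rewrite -Xlat_act // act_adjK.
move=> [y [Ay xy]].
suff -> : act h x = y by [].
have -> : x = act (\adj h) y by apply: Xlat_inj; rewrite xy Xlat_act.
by rewrite act_Kadj.
Qed.

End Lattices.

(** * Real-valued probabilities and the symmetric-difference pseudometric *)

Section Probability.
Context d (T : measurableType d) (R : realType).
Variable mu : probability T R.
Implicit Types A B C D : set T.

Definition pr A : R := fine (mu A).

Definition sdiff A B := (A `\` B) `|` (B `\` A).

(** The L^1 distance of the indicator functions; distance 0 means equality up to a null set. *)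
Definition dist A B : R := pr (sdiff A B).

Lemma prE A : measurable A -> mu A = (pr A)%:E.
Proof. by move=> mA; rewrite fineK // fin_num_measure. Qed.

Lemma pr_ge0 A : 0 <= pr A.
Proof. exact: fine_ge0. Qed.

Lemma pr_setT : pr setT = 1.
Proof. by rewrite /pr probability_setT. Qed.

Lemma pr_set0 : pr set0 = 0.
Proof. by rewrite /pr measure0. Qed.

Lemma le_pr A B : measurable A -> measurable B -> A `<=` B -> pr A <= pr B.
Proof.
by move=> mA mB AB; rewrite -lee_fin -!prE //; apply: le_measure; rewrite ?inE.
Qed.

Lemma pr_setU A B : measurable A -> measurable B -> A `&` B = set0 ->
  pr (A `|` B) = pr A + pr B.
Proof.
move=> mA mB AB; apply: EFin_inj; rewrite EFinD -!prE //; last exact: measurableU.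
by rewrite measureU.
Qed.

Lemma pr_split A B : measurable A -> measurable B ->
  pr A = pr (A `&` B) + pr (A `\` B).
Proof.
move=> mA mB; rewrite -(@pr_setU (A `&` B) (A `\` B)) ?setUIDK //.
- exact: measurableI.
- exact: measurableD.
by apply/seteqP; split => // x [[_ ?] []].
Qed.

Lemma pr_setC A : measurable A -> pr (~` A) = 1 - pr A.
Proof.
move=> mA; rewrite -pr_setT (pr_split (A := setT) measurableT mA) setTI setTD.
by rewrite addrC addKr.
Qed.

Lemma pr_le1 A : measurable A -> pr A <= 1.
Proof. by move=> mA; rewrite -pr_setT; apply: le_pr. Qed.

Lemma pr_setU_le A B : measurable A -> measurable B -> pr (A `|` B) <= pr A + pr B.
Proof.
move=> mA mB; rewrite (_ : A `|` B = (A `\` B) `|` B); last first.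
  by apply/seteqP; split => x /=; have [|] := pselect (B x); tauto.
rewrite (@pr_setU (A `\` B) B); [|exact: measurableD|by []|by apply/seteqP; split => // x [[? ?] ?]].
by rewrite lerD2r; apply: le_pr => //; exact: measurableD.
Qed.

Lemma measurable_sdiff A B : measurable A -> measurable B -> measurable (sdiff A B).
Proof. by move=> mA mB; apply: measurableU; apply: measurableD. Qed.

Lemma le_dist2 A B C D A' B' : measurable A -> measurable B -> measurable C ->
  measurable D -> measurable A' -> measurable B' ->
  sdiff A B `<=` sdiff C D `|` sdiff A' B' -> dist A B <= dist C D + dist A' B'.
Proof.
move=> mA mB mC mD mA' mB' sub; have m := measurable_sdiff.
apply: (le_trans _ (pr_setU_le (m _ _ mC mD) (m _ _ mA' mB'))).
by apply: le_pr; [exact: m|apply: measurableU; exact: m|].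
Qed.

Lemma distC A B : dist A B = dist B A.
Proof. by rewrite /dist /sdiff setUC. Qed.

Lemma dist_triangle A B C : measurable A -> measurable B -> measurable C ->
  dist A C <= dist A B + dist B C.
Proof.
move=> mA mB mC; apply: le_dist2 => // x; rewrite /sdiff /=.
by have [|] := pselect (B x); tauto.
Qed.

Lemma distCC A B : dist (~` A) (~` B) = dist A B.
Proof.
congr pr; rewrite /sdiff; apply/seteqP; split => x /=;
  by have [|] := pselect (A x); have [|] := pselect (B x); tauto.
Qed.

Lemma dist_setU A B C D : measurable A -> measurable B -> measurable C ->
  measurable D -> dist (A `|` C) (B `|` D) <= dist A B + dist C D.
Proof.
move=> mA mB mC mD; apply: le_dist2 => //; [exact: measurableU..|].
by move=> x; rewrite /sdiff /=; tauto.
Qed.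

Lemma ler_dist_pr A B : measurable A -> measurable B -> `|pr A - pr B| <= dist A B.
Proof.
move=> mA mB; rewrite (pr_split mA mB) (pr_split mB mA) setIC opprD addrACA subrr add0r.
rewrite /dist /sdiff (@pr_setU (A `\` B) (B `\` A)); [|exact: measurableD..|by apply/seteqP; split => // x [[? ?] []]].
by apply: le_trans (ler_normB _ _) _; rewrite !ger0_norm ?pr_ge0.
Qed.

Lemma dist_setIr A B C : measurable A -> measurable B -> measurable C ->
  dist (C `&` A) (C `&` B) <= dist A B.
Proof.
move=> mA mB mC; apply: le_pr.
- by apply: measurable_sdiff; exact: measurableI.
- exact: measurable_sdiff.
- by move=> x; rewrite /sdiff /=; tauto.
Qed.

(** Sets of equal measure have one-sided differences of equal measure. A set and its translate are
    such a pair, so only one side has to be estimated. *)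
Lemma dist_diff A B : measurable A -> measurable B -> pr A = pr B ->
  dist A B = pr (B `\` A) *+ 2.
Proof.
move=> mA mB AB; rewrite /dist /sdiff (@pr_setU (A `\` B) (B `\` A)); [|exact: measurableD..|by apply/seteqP; split => // x [[? ?] []]].
rewrite mulr2n; congr (_ + _); apply/eqP; rewrite -(inj_eq (addrI (pr (A `&` B)))).
by rewrite -(pr_split mA mB) AB (pr_split mB mA) setIC.
Qed.

Lemma cvg_pr_decr (S : nat -> set T) : (forall n, measurable (S n)) ->
  (forall m n, (m <= n)%N -> S n `<=` S m) -> \bigcap_n S n = set0 ->
  (fun n => pr (S n)) @ \oo --> (0 : R).
Proof.
move=> mS decS S0; have : mu \o S @ \oo --> mu (\bigcap_n S n).
  apply: nonincreasing_cvg_mu => //.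
  - by apply: (le_lt_trans (probability_le1 _ _)) => //; rewrite ltry.
  - exact: bigcap_measurable.
  - by move=> m n mn; apply/subsetPset; exact: decS.
by rewrite S0 measure0; exact: fine_cvg.
Qed.

Lemma cvg_pr_bigcup (F : nat -> set T) : (forall n, measurable (F n)) ->
  (fun n => pr ((\bigcup_i F i) `\` (\big[setU/set0]_(i < n) F i))) @ \oo --> (0 : R).
Proof.
move=> mF; apply: cvg_pr_decr.
- move=> n; apply: measurableD; first exact: bigcup_measurable.
  exact: bigsetU_measurable.
- move=> m n mn x [Fx nF]; split => // Fm; apply: nF.
  by move: x {Fx} Fm; apply: subset_bigsetU.
- apply/seteqP; split => // x h; have [[i _ Fi] _] := h 0%N I.
  have [_] := h i.+1 I; apply.
  by rewrite big_ord_recr /=; right.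
Qed.

End Probability.

(** * Continuity of translation in measure *)

Section Continuity.
Variables (R : realType) (d : nat).
Implicit Types (g : 'M[R]_d) (h : nat -> 'M[R]_d) (q : 'M[rat]_d).

Notation intm := (map_mx (intr : int -> R)).
Notation ratm := (map_mx (ratr : rat -> R)).

Definition mxcvg (T : Type) (F : set_system T) (h : T -> 'M[R]_d) g :=
  forall i j, (fun t => h t i j) @ F --> g i j.

Lemma mxcvg_mul (T : Type) (F : set_system T) (FF : Filter F) (h k : T -> 'M[R]_d) a b :
  mxcvg F h a -> mxcvg F k b -> mxcvg F (fun t => h t *m k t) (a *m b).
Proof.
move=> ha kb i j; under eq_fun do rewrite mxE; rewrite mxE.
apply: cvg_big => [|l _]; first exact: add_continuous.
exact: cvgM.
Qed.

Lemma mxcvg_cst (T : Type) (F : set_system T) (FF : Filter F) a :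
  mxcvg F (fun=> a) a.
Proof. by move=> i j; exact: cvg_cst. Qed.

Lemma mxcvg_close (T : Type) (F : set_system T) (FF : Filter F) (h : T -> 'M[R]_d) g e :
  mxcvg F h g -> 0 < e ->
  \forall t \near F, forall ij : 'I_d * 'I_d, `|g ij.1 ij.2 - h t ij.1 ij.2| < e.
Proof.
move=> hg e0; apply: filter_forall => -[i j] /=.
by have /cvgrPdist_lt := hg i j; apply.
Qed.

Lemma mxcvg_near (T : Type) (F : set_system T) (FF : Filter F) (h : T -> 'M[R]_d) g
    (O : set 'M[R]_d) :
  mxcvg F h g -> open O -> O g -> \forall t \near F, O (h t).
Proof.
move=> hg oO Og; have /nbhs_ballP[e /= e0 eO] : nbhs g O by exact: open_nbhs_nbhs.
have := mxcvg_close FF hg e0.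
by apply: filterS => n hn; apply: eO; split => // i j; exact: (hn (i, j)).
Qed.

Lemma mxcvg_id g : mxcvg (nbhs g) id g.
Proof. by move=> i j; exact: coord_continuous. Qed.

Lemma mxcvg_norm (T : Type) (F : set_system T) (FF : Filter F) (h : T -> 'M[R]_d) a b i j :
  mxcvg F h a -> (fun t => `|(h t - b) i j|) @ F --> `|(a - b) i j|.
Proof.
move=> ha; have E c : (c - b) i j = c i j - b i j by rewrite !mxE.
rewrite E; under eq_fun do rewrite E.
by apply: cvg_norm; apply: cvgB; [exact: ha|exact: cvg_cst].
Qed.

(* The radius is small enough that [|a - 1|, |c a - 1| < chart_radius] forces [c = 1] for an
   integer matrix [c]. *)
Definition chart_radius : R := (4 * d.+1%:R)^-1.

(** Matrices almost inverted by a rational matrix [q]; [unpickle] arranges the countably many [q] in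
    a sequence. *)
Definition chart (n : nat) : set 'M[R]_d :=
  if unpickle n is Some q
  then [set g | forall ij : 'I_d * 'I_d,
    `|(g *m ratm q - 1%:M) ij.1 ij.2| < chart_radius]
  else set0.

Lemma chart_radius_gt0 : 0 < chart_radius.
Proof. by rewrite invr_gt0 mulr_gt0. Qed.

Lemma chart_cover g : \det g = 1 -> exists n, chart n g.
Proof.
move=> g1; pose K : R := \sum_i \sum_j `|g i j|.
have K0 : 0 <= K by apply: sumr_ge0 => i _; apply: sumr_ge0.
(* [K] dominates every row sum of [g], so an error [e] in the entries of the inverse becomes at most
   [K * e < chart_radius] after multiplication by [g]. *)
pose e := chart_radius / (K + 1).
have e0 : 0 < e by rewrite divr_gt0 ?chart_radius_gt0 // ltr_wpDl.
have /choice[q hq] : forall ij : 'I_d * 'I_d, exists x : rat,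
    ratr x \in `](\adj g ij.1 ij.2), (\adj g ij.1 ij.2 + e)[.
  by move=> ij; apply: rat_in_itvoo; rewrite ltrDl.
exists (pickle (\matrix_(i, j) q (i, j))); rewrite /chart pickleK => -[i j] /=.
rewrite -(mulmx_adj1 g1) -mulmxBr mxE.
apply: (@le_lt_trans _ _ (\sum_k `|g i k| * e)).
  apply: le_trans (ler_norm_sum _ _ _) _; apply: ler_sum => k _.
  rewrite normrM; apply: ler_wpM2l => //; rewrite !mxE.
  move: (hq (k, j)); rewrite in_itv /= !mxE => /andP[h1 h2].
  by rewrite ltW // ltr_norml; apply/andP; split; lra.
rewrite -mulr_suml /e mulrCA -[ltRHS]mulr1 ltr_pM2l ?chart_radius_gt0 //.
rewrite ltr_pdivrMr ?mul1r; last by rewrite ltr_wpDl.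
rewrite ltr_pwDr // /K [leRHS](bigD1 i) //= lerDl.
by apply: sumr_ge0 => k _; apply: sumr_ge0.
Qed.

Lemma chart_open n : open (chart n).
Proof.
rewrite /chart; case: unpickle => [q|]; last exact: open0.
rewrite openE => g hg.
apply: (@filter_forall _ _ (fun (ij : 'I_d * 'I_d) (k : 'M[R]_d) =>
    `|(k *m ratm q - 1%:M) ij.1 ij.2| < chart_radius) (nbhs g)) => ij.
have := hg ij.
have mg : mxcvg (nbhs g) (fun k => k *m ratm q) (g *m ratm q).
  by apply: mxcvg_mul; [exact: mxcvg_id|exact: mxcvg_cst].
have := mxcvg_norm (b := 1%:M) (i := ij.1) (j := ij.2) _ mg.
by move=> cv lt; exact: (@cvgr_lt _ _ (nbhs g) _ _ _ (cv _) _ lt).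
Qed.

(** With [e = c - 1] and [a = g q], one has [e = (c a - 1) - (a - 1) - e (a - 1)]. A row sum [S] of
    [|e|] thus satisfies [S <= (2 + S) / 4], so [S < 1], and integer entries smaller than 1
    vanish. *)
Lemma chart_inj n g (c : 'M[int]_d) : chart n g -> chart n (intm c *m g) -> c = 1%:M.
Proof.
rewrite /chart; case: unpickle => [q|//] /=; rewrite -mulmxA; set a := g *m ratm q => ha hb.
pose e := intm c - 1%:M.
have eE i j : e i j = (intm c *m a - 1%:M) i j - (a - 1%:M) i j - (e *m (a - 1%:M)) i j.
  by rewrite mulmxBr mulmx1 mulmxBl mul1mx !mxE; ring.
have dd : d%:R * chart_radius <= 4^-1.
  rewrite /chart_radius invfM mulrCA ler_piMr // ler_pdivrMr // mul1r ler_nat.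
  exact: leqnSn.
have d0 := chart_radius_gt0.
suff e0 i : \sum_j `|e i j| < 1.
  apply/matrixP => i j; apply/eqP; rewrite -subr_eq0; apply/eqP.
  have : `|e i j| < 1.
    by apply: le_lt_trans (e0 i); rewrite (bigD1 j) //= lerDl sumr_ge0.
  have -> : e i j = (c i j - 1%:M i j)%:~R by rewrite /e !mxE intrB; case: (i == j).
  by rewrite -intr_norm -[ltRHS]/(1%:~R) ltr_int => z1; apply/eqP;
    rewrite -normr_le0 -ltzD1 add0r.
have : \sum_j `|e i j| <= \sum_(j < d) (2 * chart_radius + \sum_k `|e i k| * chart_radius).
  apply: ler_sum => j _; rewrite {1}eE.
  apply: le_trans (ler_normB _ _) _; apply: lerD.
    apply: le_trans (ler_normB _ _) _.
    by have := hb (i, j); have := ha (i, j); rewrite /=; lra.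
  rewrite mxE; apply: le_trans (ler_norm_sum _ _ _) _; apply: ler_sum => k _.
  by rewrite normrM ler_wpM2l // ltW // (ha (k, j)).
rewrite sumr_const card_ord -mulr_suml -[X in _ <= X -> _]mulr_natl.
have : 0 <= \sum_j `|e i j| by apply: sumr_ge0.
move: dd; set S := \sum_j _; set dl := _ * _.
have -> : d%:R * (2 * chart_radius + S * chart_radius) = dl * (2 + S).
  by rewrite /dl; ring.
move=> dl4 S0 h; have : dl * (2 + S) <= 4^-1 * (2 + S) by apply: ler_wpM2r => //; lra.
lra.
Qed.

Lemma chart_pi_inj n g1 g2 : \det g1 = 1 -> \det g2 = 1 -> chart n g1 -> chart n g2 ->
  piX g1 = piX g2 -> g1 = g2.
Proof.
move=> d1 d2 c1 c2 /(pi_inj d1 d2)[c _ e].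
by move: c2; rewrite {}e => /(chart_inj c1) ->; rewrite map_mx1 mul1mx.
Qed.

Variable mu : probability (X R d) R.
Hypothesis hmu : right_SL_invariant mu.
Variable h : nat -> 'M[R]_d.
Hypothesis h1 : forall n, \det (h n) = 1.
Hypothesis hcvg : mxcvg \oo h 1%:M.
Implicit Types (A B : set (X R d)).

Definition L1cont A :=
  measurable A /\ (fun n => dist mu (act (h n) @^-1` A) A) @ \oo --> (0 : R).

Lemma pr_act g A : \det g = 1 -> measurable A -> pr mu (act g @^-1` A) = pr mu A.
Proof. by move=> g1 mA; rewrite /pr mu_act. Qed.

Lemma dist_act g A B : \det g = 1 -> measurable A -> measurable B ->
  dist mu (act g @^-1` A) (act g @^-1` B) = dist mu A B.
Proof. by move=> g1 mA mB; rewrite /dist -(pr_act g1 (measurable_sdiff mA mB)). Qed.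

Lemma dist_act_fwd g A B : \det g = 1 -> measurable A -> measurable B ->
  dist mu A (act g @^-1` B) = dist mu (act (\adj g) @^-1` A) B.
Proof.
move=> g1 mA mB; rewrite -(dist_act g1 _ mB); last first.
  by apply: measurable_act => //; exact: det_adj1.
congr (dist _ _ _); apply/seteqP.
by split => x /=; rewrite act_adjK.
Qed.

(** Each point of the image has a lift in [O], which stays in [O] under all late [h n]. The sets of
    points that still leave after time [k] decrease to the empty set, so their measures tend to
    0. *)
Lemma L1cont_open (O : set 'M[R]_d) : open O ->
  L1cont [set piX g | g in O `&` [set g | \det g = 1]].
Proof.
move=> oO; set U := [set piX g | g in _].
have mU : measurable U.
  by apply: measurable_pi; apply: sub_sigma_algebra.
have mUn n : measurable (act (h n) @^-1` U) by exact: measurable_act.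
split => //.
pose S k := \bigcup_(n in [set n | (k <= n)%N]) (U `\` act (h n) @^-1` U).
have mS k : measurable (S k) by apply: bigcup_measurable => n _; exact: measurableD.
have : (fun n => pr mu (S n)) @ \oo --> (0 : R).
  apply: cvg_pr_decr => //.
    by move=> k l kl x [n /= ln Ux]; exists n => //=; exact: leq_trans ln.
  apply/seteqP; split => // x Sx.
  have [_ _ [[g [Og g1] gx] _]] := Sx 0%N I.
  have [K _ KO] : \forall n \near \oo, O (g *m h n).
    apply: (@mxcvg_near _ _ _ _ g) => //; rewrite -[g in mxcvg _ _ g]mulmx1.
    by apply: mxcvg_mul; [exact: mxcvg_cst|].
  have [n /= Kn [_]] := Sx K I; apply.
  exists (g *m h n); last by rewrite -gx act_pi.
  by split; [exact: KO|rewrite /= det_mul1].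
move=> S0.
have S2 : (fun n => pr mu (S n) + pr mu (S n)) @ \oo --> (0 : R).
  by rewrite -[X in _ --> X]addr0; exact: cvgD.
apply: (squeeze_cvgr _ (cvg_cst (0 : R)) S2); apply: nearW => n.
rewrite pr_ge0 /= dist_diff ?pr_act // -mulr2n lerMn2r /=.
apply: le_pr => //; first exact: measurableD.
by move=> x Ux; exists n => //=.
Qed.

Lemma L1cont_setC A : L1cont A -> L1cont (~` A).
Proof.
move=> [mA cA]; split; first exact: measurableC.
by under eq_fun do rewrite preimage_setC distCC.
Qed.

Lemma L1cont_set0 : L1cont set0.
Proof.
split => //; under eq_fun do rewrite preimage_set0 /dist /sdiff setD0 setU0 pr_set0.
exact: cvg_cst.
Qed.

Lemma L1cont_setU A B : L1cont A -> L1cont B -> L1cont (A `|` B).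
Proof.
move=> [mA cA] [mB cB]; split; first exact: measurableU.
have cAB : (fun n => dist mu (act (h n) @^-1` A) A + dist mu (act (h n) @^-1` B) B) @ \oo
    --> (0 : R) by rewrite -[X in _ --> X]addr0; exact: cvgD.
apply: (squeeze_cvgr _ (cvg_cst (0 : R)) cAB); apply: nearW => n.
by rewrite pr_ge0 /= preimage_setU; apply: dist_setU => //; exact: measurable_act.
Qed.

(** A finite subunion approximates the whole union equally well after translation, since translation
    preserves [dist]; the finite union handles the remaining third of [e]. *)
Lemma L1cont_bigcup (F : nat -> set (X R d)) :
  (forall n, L1cont (F n)) -> L1cont (\bigcup_n F n).
Proof.
move=> cF; have mF n : measurable (F n) by have [] := cF n.
have mU : measurable (\bigcup_n F n) by exact: bigcup_measurable.
split => //; apply/cvgrPdist_le => /= e e0.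
have /cvgrPdist_le/(_ (e / 3)) := cvg_pr_bigcup mu mF.
rewrite divr_gt0 // => /(_ isT)[N _ /(_ N (leqnn _))] /=.
set B := \big[setU/set0]_(i < N) F i; rewrite sub0r normrN ger0_norm ?pr_ge0 // => hN.
have mB : measurable B by exact: bigsetU_measurable.
have : L1cont B.
  rewrite /B; elim: (N) => [|k IH]; first by rewrite big_ord0; exact: L1cont_set0.
  by rewrite big_ord_recr; exact: L1cont_setU.
move=> [_ /cvgrPdist_le/(_ (e / 3))]; rewrite divr_gt0 // => /(_ isT).
apply: filterS => n; rewrite !sub0r !normrN !ger0_norm ?pr_ge0 // => hn.
have mact A : measurable A -> measurable (act (h n) @^-1` A) by exact: measurable_act.
have dB : dist mu (\bigcup_n F n) B <= e / 3.
  apply: le_trans hN; apply: le_pr; [exact: measurable_sdiff|exact: measurableD|].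
  move=> x [//|[Bx []]]; move: x Bx; exact: bigsetU_bigcup.
apply: le_trans (dist_triangle mu (mact _ mU) (mact _ mB) mU) _.
rewrite dist_act //; have := dist_triangle mu (mact _ mB) mB mU.
rewrite (distC _ B); lra.
Qed.

Lemma chart_coverX A : A = \bigcup_n
  [set piX g | g in [set g | \det g = 1 /\ A (piX g)] `&` chart n `&` [set g | \det g = 1]].
Proof.
apply/seteqP; split => x.
  have [g g1 ->] := pi_surj x => Ax.
  by have [n ng] := chart_cover g1; exists n => //; exists g.
by move=> [n _ [g [[[g1 Ag] _] _] <-]].
Qed.

(** Without injectivity on the chart this fails: a point could have one lift in [C] and another
    outside. *)
Lemma chart_imageC n (C : set 'M[R]_d) :
  [set piX g | g in ~` C `&` chart n `&` [set g | \det g = 1]] =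
  [set piX g | g in chart n `&` [set g | \det g = 1]] `\`
  [set piX g | g in C `&` chart n `&` [set g | \det g = 1]].
Proof.
apply/seteqP; split => x /=.
  move=> [g [[nC cg] g1] <-]; split; first by exists g.
  by move=> [g' [[Cg' cg'] g1']] /(chart_pi_inj g1' g1 cg' cg) e; apply: nC; rewrite -e.
move=> [[g [cg g1] gx] nC]; exists g => //; split => //; split => // Cg; apply: nC.
by exists g.
Qed.

(* Each chart is an open set on which [piX] is injective, so images of Borel subsets of
   a chart inherit continuity from the images of open ones. *)
Lemma L1cont_chart n (C : set 'M[R]_d) : borel_mx C ->
  L1cont [set piX g | g in C `&` chart n `&` [set g | \det g = 1]].
Proof.
move: C; apply: smallest_sub => [|O oO] /=; last first.
  by apply: L1cont_open; apply: openI; [exact: oO|exact: chart_open].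
split => /=.
- rewrite !set0I image_set0; exact: L1cont_set0.
- move=> C cC; rewrite setTD chart_imageC setDE -[X in X `&` _]setCK -setCU.
  apply: L1cont_setC; apply: L1cont_setU => //.
  by apply: L1cont_setC; apply: L1cont_open; exact: chart_open.
- by move=> F cF; rewrite !setI_bigcupl image_bigcup; exact: L1cont_bigcup.
Qed.

Lemma measurable_L1cont A : measurable A -> L1cont A.
Proof.
move=> /measurable_XE bA; rewrite (chart_coverX A).
by apply: L1cont_bigcup => n; exact: L1cont_chart.
Qed.

End Continuity.

(** * Elementary matrices and the Mautner phenomenon *)

Section Elementary.
Variable F : fieldType.

Definition elem n (i j : 'I_n) (s : F) : 'M[F]_n := 1%:M + s *: delta_mx i j.

Lemma det_elem n (i j : 'I_n) s : i != j -> \det (elem i j s) = 1.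
Proof.
(* Row [i] of [elem i j s] is row [i] of the identity plus [s] times row [j]. By multilinearity the
   determinant is 1 plus [s * \det C], and [C] has two equal rows. *)
move=> ij; pose C : 'M[F]_n := \matrix_k (if k == i then row j 1%:M else row k 1%:M).
have det_C : \det C = 0.
  apply: (determinant_alternate ij) => k.
  by rewrite !mxE eqxx [j == i]eq_sym (negbTE ij) !mxE.
have := @determinant_multilinear F n (elem i j s) 1%:M C i 1 s.
rewrite det_C det1 mulr0 addr0 mulr1; apply.
- by apply/rowP => k; rewrite !mxE eqxx !mxE mul1r [j == k]eq_sym.
- apply/matrixP => k l; rewrite !mxE [lift i k == i]eq_sym (negbTE (neq_lift i k)).
  by rewrite mulr0 addr0.
- apply/matrixP => k l; rewrite !mxE [lift i k == i]eq_sym (negbTE (neq_lift i k)) !mxE.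
  by rewrite mulr0 addr0.
Qed.

Lemma elem_mul n (i j : 'I_n) s t : i != j -> elem i j s *m elem i j t = elem i j (s + t).
Proof.
move=> ij; rewrite /elem !(mulmxDl, mulmxDr, mulmx1, mul1mx) -!(scalemxAl, scalemxAr).
rewrite mul_delta_mx_0 1?eq_sym // !scaler0 addr0.
by apply/matrixP => a b; rewrite !mxE; ring.
Qed.

Lemma elem0 n (i j : 'I_n) : elem i j 0 = 1%:M.
Proof. by rewrite /elem scale0r addr0. Qed.

Lemma elem_invl n (i j : 'I_n) s (g : 'M[F]_n) : i != j ->
  elem i j (- s) *m (elem i j s *m g) = g.
Proof. by move=> ij; rewrite mulmxA elem_mul // addNr elem0 mul1mx. Qed.

Lemma elem_commutator n (i j k : 'I_n) s : i != j -> k != j -> i != k ->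
  elem i j s *m elem j k 1 *m elem i j (- s) *m elem j k (- 1) = elem i k s.
Proof.
move=> ij kj ik; have [ji jk ki] : [/\ j != i, j != k & k != i].
  by rewrite eq_sym ij eq_sym kj eq_sym ik.
rewrite /elem !(mulmxDl, mulmxDr, mulmx1, mul1mx) -!(scalemxAl, scalemxAr).
rewrite !(mul_delta_mx, mul_delta_mx_0) // !(mul0mx, scaler0, addr0, add0r).
by apply/matrixP => a b; rewrite !mxE; ring.
Qed.

Lemma elem_mull_entry n (i j : 'I_n) s (g : 'M[F]_n) l :
  (elem i j s *m g) i l = g i l + s * g j l.
Proof.
rewrite /elem mulmxDl mul1mx -scalemxAl !mxE; congr (_ + _ * _).
rewrite (bigD1 j) //= mxE !eqxx mul1r big1 ?addr0 // => k kj.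
by rewrite mxE (negbTE kj) andbF mul0r.
Qed.

Lemma block_elem_dl n (i : 'I_n) s :
  block_mx 1%:M 0 (s *: delta_mx i 0) 1%:M =
  elem (rshift 1 i) (lshift n (@ord0 0)) s :> 'M[F]_(1 + n).
Proof.
apply/matrixP => x y; case: (split_ordP x) => x' ->; case: (split_ordP y) => y' ->;
  rewrite ?(block_mxEul, block_mxEur, block_mxEdl, block_mxEdr) !mxE !eq_shift;
  by rewrite ?andbF ?mulr0 ?addr0 ?add0r.
Qed.

Lemma block_elem_ur n (i : 'I_n) s :
  block_mx 1%:M (s *: delta_mx 0 i) 0 1%:M =
  elem (lshift n (@ord0 0)) (rshift 1 i) s :> 'M[F]_(1 + n).
Proof.
apply/matrixP => x y; case: (split_ordP x) => x' ->; case: (split_ordP y) => y' ->;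
  rewrite ?(block_mxEul, block_mxEur, block_mxEdl, block_mxEdr) !mxE !eq_shift;
  by rewrite ?andbF ?mulr0 ?addr0 ?add0r.
Qed.

Lemma block_elem_dr n (i j : 'I_n) s :
  block_mx 1%:M 0 0 (elem i j s) = elem (rshift 1 i) (rshift 1 j) s :> 'M[F]_(1 + n).
Proof.
apply/matrixP => x y; case: (split_ordP x) => x' ->; case: (split_ordP y) => y' ->;
  rewrite ?(block_mxEul, block_mxEur, block_mxEdl, block_mxEdr) !mxE !eq_shift;
  by rewrite ?andbF ?mulr0 ?addr0 ?add0r.
Qed.

(** Gaussian elimination by induction on the size. Once the corner entry is 1, the matrix is a lower
    unipotent, a block-diagonal and an upper unipotent factor, and the induction hypothesis treats
    the block. *)
Lemma SL_gen n (P : 'M[F]_n -> Prop) : P 1%:M ->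
  (forall a b, P a -> P b -> P (a *m b)) ->
  (forall i j s, i != j -> P (elem i j s)) ->
  forall g, \det g = 1 -> P g.
Proof.
elim: n P => [|n IH] P P1 PM Pe g g1; first by rewrite (flatmx0 g) -(flatmx0 1%:M).
have Pinv i j s (a : 'M[F]_n.+1) : i != j -> P (elem i j s *m a) -> P a.
  by move=> ij Pa; rewrite -(elem_invl s a ij); apply: PM => //; exact: Pe.
have P00 (a : 'M[F]_n.+1) : \det a = 1 -> a ord0 ord0 = 1 -> P a.
  move=> a1 a00; pose A : 'M[F]_(1 + n) := a.
  have PM' (b c : 'M[F]_(1 + n)) : P b -> P c -> P (b *m c) by exact: PM.
  have PL (c : 'cV[F]_n) : P (block_mx 1%:M 0 c 1%:M : 'M[F]_(1 + n)).
    rewrite [c]matrix_sum_delta.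
    elim/big_ind: _ => [|c1 c2 h1 h2|i _].
    - by rewrite -scalar_mx_block.
    - have := PM' _ _ h1 h2; rewrite mulmx_block !(mulmx1, mul1mx, mul0mx, mulmx0).
      by rewrite !(addr0, add0r) addrC.
    by rewrite big_ord1 block_elem_dl; exact: Pe.
  have PU (c : 'rV[F]_n) : P (block_mx 1%:M c 0 1%:M : 'M[F]_(1 + n)).
    rewrite [c]matrix_sum_delta big_ord1.
    elim/big_ind: _ => [|c1 c2 h1 h2|i _].
    - by rewrite -scalar_mx_block.
    - have := PM' _ _ h1 h2; rewrite mulmx_block !(mulmx1, mul1mx, mul0mx, mulmx0).
      by rewrite !(addr0, add0r) addrC.
    by rewrite block_elem_ur; exact: Pe.
  (* The Schur complement of the corner entry 1; its determinant is that of [A]. *)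
  pose D := drsubmx A - dlsubmx A *m ursubmx A.
  have AE : A = block_mx 1%:M 0 (dlsubmx A) 1%:M *m block_mx 1%:M 0 0 D
      *m block_mx 1%:M (ursubmx A) 0 1%:M.
    rewrite !mulmx_block !(mulmx1, mul1mx, mul0mx, mulmx0, addr0, add0r) /D addrC subrK.
    rewrite -{1}[A]submxK; congr block_mx.
    by apply/matrixP => x y; rewrite !ord1 !mxE -a00; congr (a _ _); apply: val_inj.
  have D1 : \det D = 1.
    have : \det A = 1 := a1.
    rewrite AE !det_mulmx !det_lblock !det_ublock !det1 !mul1r !mulr1.
    by [].
  rewrite -/A AE; apply: (PM' _ _ _ (PU _)); apply: (PM' _ _ (PL _)).
  apply: (IH (fun D => P (block_mx 1%:M 0 0 D : 'M[F]_(1 + n)))) D1.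
  - by rewrite -scalar_mx_block.
  - move=> b c Pb Pc; have := PM' _ _ Pb Pc.
    by rewrite mulmx_block !(mulmx1, mul1mx, mul0mx, mulmx0, addr0, add0r).
  - by move=> i j s ij; rewrite block_elem_dr; apply: Pe; apply: contra_neq ij => e; exact: (@rshift_inj 1 n _ _ e).
have Pi0 (a : 'M[F]_n.+1) i : \det a = 1 -> i != ord0 -> a i ord0 != 0 -> P a.
  (* Adding [s] times row [i] to row 0 makes the corner equal to 1. *)
  move=> a1 i0 ai; pose s := (1 - a ord0 ord0) / a i ord0.
  have i0' : ord0 != i by rewrite eq_sym.
  apply: (@Pinv ord0 i s) => //; apply: P00.
    by rewrite det_mulmx det_elem ?mul1r.
  by rewrite elem_mull_entry /s divfK // addrC subrK.
have [[i /andP[i0 gi]]|nex] := pselect (exists i, (i != ord0) && (g i ord0 != 0)).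
  exact: (Pi0 g i).
have gz i : i != ord0 -> g i ord0 = 0.
  by move=> i0; apply/eqP/negPn/negP => gi; apply: nex; exists i; rewrite i0.
have gdet : g ord0 ord0 * \det (row' ord0 (col' ord0 g)) = 1.
  rewrite -g1 (expand_det_col g ord0) (bigD1 ord0) //= big1 ?addr0.
    by rewrite /cofactor addn0 expr0 mul1r.
  by move=> i i0; rewrite gz // mul0r.
(* The first column now vanishes below the corner. In size 1 the determinant makes the corner 1;
   otherwise the corner is nonzero, and adding row 0 to row 1 leads back to [Pi0]. *)
case: n => [|n] in IH P P1 PM Pe g g1 Pinv P00 Pi0 nex gz gdet *.
  by apply: P00 => //; move: gdet; rewrite det_mx00 mulr1.
have g00 : g ord0 ord0 != 0.
  by apply/eqP => z; move: gdet; rewrite z mul0r => /esym/eqP; rewrite oner_eq0.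
apply: (@Pinv (lift ord0 ord0) ord0 1) => //; apply: (Pi0 _ (lift ord0 ord0)) => //.
  by rewrite det_mulmx det_elem ?mul1r.
by rewrite elem_mull_entry gz // mul1r add0r.
Qed.
End Elementary.

Section Mautner.
Variables (R : realType) (d : nat).
Variable mu : probability (X R d) R.
Hypothesis hmu : right_SL_invariant mu.
Variable A : set (X R d).
Hypothesis mA : measurable A.
Implicit Types (g h : 'M[R]_d) (i j k : 'I_d).

Let len g := dist mu (act g @^-1` A) A.

Let mact g : \det g = 1 -> measurable (act g @^-1` A).
Proof. by move=> g1; exact: measurable_act. Qed.

Lemma len_ge0 g : 0 <= len g.
Proof. exact: pr_ge0. Qed.

Lemma len_mul g h : \det g = 1 -> \det h = 1 -> len (g *m h) <= len g + len h.
Proof.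
move=> g1 h1; have gh1 := det_mul1 g1 h1.
rewrite /len (_ : act (g *m h) @^-1` A = act g @^-1` (act h @^-1` A)); last first.
  by apply/seteqP; split => x /=; rewrite act_comp.
have m1 : measurable (act g @^-1` (act h @^-1` A)) by apply: measurable_act => //; exact: mact.
apply: le_trans (dist_triangle mu m1 (mact g1) mA) _.
rewrite addrC lerD2l dist_act //; exact: mact.
Qed.

Lemma len1 : len 1%:M = 0.
Proof.
rewrite /len (_ : act 1%:M @^-1` A = A); last by apply/seteqP; split => x /=; rewrite act1.
by rewrite /dist /sdiff setDv setU0 pr_set0.
Qed.

Lemma len_adj g : \det g = 1 -> len (\adj g) = len g.
Proof. by move=> g1; rewrite /len -dist_act_fwd // distC. Qed.

Lemma len_elem_cvg i j (s : nat -> R) : i != j -> s @ \oo --> (0 : R) ->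
  (fun n => len (elem i j (s n))) @ \oo --> (0 : R).
Proof.
move=> ij s0.
have hc : mxcvg \oo (fun n => elem i j (s n)) 1%:M.
  move=> k l; have -> : (1%:M : 'M[R]_d) k l = (1%:M : 'M[R]_d) k l + 0 * (delta_mx i j : 'M[R]_d) k l.
    by rewrite mul0r addr0.
  rewrite (_ : (fun n => _) = (fun n => (1%:M : 'M[R]_d) k l + s n * (delta_mx i j : 'M[R]_d) k l)).
    by apply: cvgD; [exact: cvg_cst|apply: cvgMl].
  by apply/funext => n; rewrite /elem !mxE.
by have [] := measurable_L1cont hmu (fun n => det_elem (s n) ij) hc mA.
Qed.

Lemma le_limit0 (x : R) (u : nat -> R) : u @ \oo --> (0 : R) -> (forall n, x <= u n) -> x <= 0.
Proof.
move=> u0 xu; rewrite -(cvg_lim (@Rhausdorff R) u0).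
by apply: limr_ge; [apply/cvg_ex; exists 0|exact: nearW].
Qed.

(* The Mautner phenomenon in SL(2): [u(1/t) v(t) u(-1/2t) = a v(2t)] with [a = diag(2,1/2)]
   fixed, so the length of [a] is at most that of [v(t)] and [v(-2t)], which tends to 0;
   conjugation by [a] then contracts [v(s)] to the identity. *)
Lemma mautner i j : i != j -> (forall s, len (elem i j s) = 0) ->
  forall s, len (elem j i s) = 0.
Proof.
move=> ij u0.
have ji : j != i by rewrite eq_sym.
pose a : 'M[R]_d := 1%:M + delta_mx i i + (- 2^-1) *: delta_mx j j.
have aE t : t != 0 -> elem i j t^-1 *m elem j i t *m elem i j (- (2 * t)^-1) =
    a *m elem j i (2 * t).
  move=> t0; rewrite /elem /a !(mulmxBl, mulmxDl, mulmxDr, mulmx1, mul1mx,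
    =^~ scalemxAl, =^~ scalemxAr, mul_delta_mx) !mul_delta_mx_0 // !(mul0mx, scaler0).
  by apply/matrixP => x y; rewrite !mxE; field.
have aV s : a *m elem j i s = elem j i (s / 4) *m a.
  rewrite /elem /a !(mulmxBl, mulmxDl, mulmxDr, mulmxBr, mulmx1, mul1mx,
    =^~ scalemxAl, =^~ scalemxAr, mul_delta_mx) !mul_delta_mx_0 // !scaler0.
  by apply/matrixP => x y; rewrite !mxE; field.
have e1 k l s : k != l -> \det (elem k l s : 'M[R]_d) = 1 by exact: det_elem.
have a1 : \det a = 1.
  have := congr1 determinant (aE 1 (oner_neq0 _)).
  by rewrite !det_mulmx !e1 // !mulr1.
have aE' t : t != 0 -> a = elem i j t^-1 *m (elem j i t *m (elem i j (- (2 * t)^-1)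
    *m elem j i (- (2 * t)))).
  move=> t0; rewrite !mulmxA aE // -mulmxA elem_mul // subrr elem0 mulmx1 //.
have la t : t != 0 -> len a <= len (elem j i t) + len (elem j i (- (2 * t))).
  move=> t0; rewrite {1}(aE' t t0).
  have m1 : \det (elem i j (- (2 * t)^-1) *m elem j i (- (2 * t))) = 1.
    by rewrite det_mul1 ?e1.
  have m2 := det_mul1 (e1 j i t ji) m1.
  apply: le_trans (len_mul (e1 _ _ _ ij) m2) _; rewrite u0 add0r.
  apply: le_trans (len_mul (e1 _ _ _ ji) m1) _; rewrite lerD2l.
  by apply: le_trans (len_mul (e1 _ _ _ ij) (e1 _ _ _ ji)) _; rewrite u0 add0r.
have c0 : (fun n => n.+1%:R^-1 : R) @ \oo --> (0 : R) by exact: cvg_harmonic.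
have la0 : len a = 0.
  apply/eqP; rewrite eq_le len_ge0 andbT.
  have cc : (fun n => len (elem j i n.+1%:R^-1) + len (elem j i (- (2 * n.+1%:R^-1)))) @ \oo
      --> (0 : R).
    rewrite -[X in _ --> X]addr0; apply: cvgD; apply: len_elem_cvg => //.
    rewrite -oppr0; apply: cvgN; rewrite -[X in _ --> X](mulr0 2); exact: cvgMr.
  by apply: le_limit0 cc _ => n; apply: la; rewrite invr_eq0.
have lV s : len (elem j i s) <= len (elem j i (s / 4)).
  have -> : elem j i s = \adj a *m (elem j i (s / 4) *m a).
    by rewrite -aV mulmxA mul_adj1 // mul1mx.
  have m1 := det_mul1 (e1 _ _ (s / 4) ji) a1.
  apply: le_trans (len_mul (det_adj1 a1) m1) _.
  rewrite len_adj // la0 add0r.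
  by apply: le_trans (len_mul (e1 _ _ _ ji) a1) _; rewrite la0 addr0.
move=> s; apply/eqP; rewrite eq_le len_ge0 andbT.
have cs : (fun n => len (elem j i (s * 4^-1 ^+ n))) @ \oo --> (0 : R).
  apply: len_elem_cvg => //; rewrite -[X in _ --> X](mulr0 s); apply: cvgMr.
  by apply: cvg_expr; rewrite ger0_norm // invf_lt1 // ltr1n.
apply: le_limit0 cs _; elim => [|n IH]; first by rewrite expr0 mulr1.
by apply: le_trans IH _; apply: le_trans (lV _) _; rewrite exprSr mulrA.
Qed.

(** [mautner] supplies the root subgroups from the complement of [I] to [I]. Those inside one block
    are commutators through an index of the other block, which is why both blocks must be nonempty.
    Elements of length 0 are closed under products, and elementary matrices generate. *)
Lemma len_SL (I : pred 'I_d) : (exists i, I i) -> (exists j, ~~ I j) ->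
  (forall i j s, I i -> ~~ I j -> len (elem i j s) = 0) ->
  forall g, \det g = 1 -> len g = 0.
Proof.
move=> [i0 Ii0] [j0 Ij0] uI.
have neq i j : I i -> ~~ I j -> i != j.
  by move=> Ii; apply: contraNneq => <-.
have uJ i j s : I i -> ~~ I j -> len (elem j i s) = 0.
  by move=> Ii Ij; apply: mautner; [exact: neq|move=> t; exact: uI].
have e1 k l s : k != l -> \det (elem k l s : 'M[R]_d) = 1 by exact: det_elem.
pose P g := \det g = 1 /\ len g = 0.
have PM a b : P a -> P b -> P (a *m b).
  move=> [a1 la] [b1 lb]; split; first exact: det_mul1.
  apply/eqP; rewrite eq_le len_ge0 andbT.
  by apply: le_trans (len_mul a1 b1) _; rewrite la lb addr0.
suff PSL g : \det g = 1 -> P g by move=> g /PSL[].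
apply: SL_gen => //; first by split; [exact: det1|exact: len1].
have PIJ i j s : I i -> ~~ I j -> P (elem i j s).
  by move=> Ii Ij; split; [exact: e1 (neq _ _ Ii Ij)|exact: uI].
have PJI i j s : I i -> ~~ I j -> P (elem j i s).
  by move=> Ii Ij; split; [apply: e1; rewrite eq_sym; exact: neq|exact: uJ].
move=> i j s ij; have [Ii|Ii] := boolP (I i); have [Ij|Ij] := boolP (I j).
- rewrite -(elem_commutator s (neq _ _ Ii Ij0) (neq _ _ Ij Ij0) ij).
  by apply: (PM _ _ (PM _ _ (PM _ _ _ _) _) _); [exact: PIJ|exact: PJI|exact: PIJ|exact: PJI].
- exact: PIJ.
- exact: PJI.
- have [ii0 ji0] : i != i0 /\ j != i0 by rewrite ![_ == i0]eq_sym !neq.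
  rewrite -(elem_commutator s ii0 ji0 ij).
  by apply: (PM _ _ (PM _ _ (PM _ _ _ _) _) _); [exact: PJI|exact: PIJ|exact: PJI|exact: PIJ].
Qed.

End Mautner.

(** * Ergodicity *)

Section Fubini.
Context dT (T : measurableType dT) (R : realType) (mu : probability T R).

Lemma fubini_null (Q : set (T * T)) : measurable Q ->
  (forall y, mu (xsection Q y) = 0%E) -> \forall x \ae mu, mu (ysection Q x) = 0%E.
Proof.
move=> mQ Q0.
have mY := measurable_fun_ysection mu mQ.
have : (\int[mu]_x `|(mu \o ysection Q) x| = 0)%E.
  under eq_integral do rewrite gee0_abs //.
  rewrite -(indic_fubini_tonelli_GE mu mQ) -(indic_fubini_tonelli mu mu mQ).
  rewrite indic_fubini_tonelli_FE //; under eq_integral do rewrite /= Q0.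
  exact: integral0.
move/(ae_eq_integral_abs mu measurableT mY).
by apply: filterS => x /(_ I).
Qed.

End Fubini.

Section Ergodicity.
Variables (R : realType) (d : nat).
Implicit Types (g h : 'M[R]_d) (c : 'M[int]_d) (x y w : X R d).

Notation intm := (map_mx (intr : int -> R)).

Lemma chart_index x : exists n, (exists g, [/\ \det g = 1, piX g = x & chart n g]) /\
  forall m, (m < n)%N -> ~ exists g, [/\ \det g = 1, piX g = x & chart m g].
Proof.
pose P n := `[< exists g, [/\ \det g = 1, piX g = x & chart n g] >].
have [|n /asboolP Pn minn] := @ex_minnP P.
  have [g g1 gx] := pi_surj x; have [n ng] := chart_cover g1.
  by exists n; apply/asboolP; exists g.
exists n; split => // m mn hm; have := minn m (asboolT hm).
by rewrite leqNgt mn.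
Qed.

(** Each point takes its lift from the first chart that contains one. Within a chart the lift is
    unique, so the preimage of a Borel condition is an image under [piX], minus the points caught by
    earlier charts. *)
Lemma measurable_section : exists s : X R d -> 'M[R]_d,
  [/\ forall x, \det (s x) = 1, forall x, piX (s x) = x & mxent s].
Proof.
have /choice[idx hidx] := chart_index.
have /choice[s hs] x : exists g, [/\ \det g = 1, piX g = x & chart (idx x) g].
  by have [] := hidx x.
have s1 x : \det (s x) = 1 by have [] := hs x.
exists s; split => // [x|]; first by have [] := hs x.
move=> i j _ B mB; rewrite setTI.
pose SL := [set g : 'M[R]_d | \det g = 1].
pose C n := chart n `&` [set g : 'M[R]_d | B (g i j)].
pose T n : set (X R d) := [set piX g | g in chart n `&` SL].
rewrite (_ : _ @^-1` _ = \bigcup_n ([set piX g | g in C n `&` SL] `\`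
    \big[setU/set0]_(m < n) T m)).
  have bchart n : borel_mx (@chart R d n).
    by apply: sub_sigma_algebra; exact: chart_open.
  apply: bigcup_measurable => n _; apply: measurableD.
    apply: measurable_pi; rewrite borel_mxE; apply: measurableI; first exact: bchart.
    rewrite -[X in measurable X]setTI; exact: mxent_id.
  by apply: bigsetU_measurable => m _; apply: measurable_pi; exact: bchart.
apply/seteqP; split => x.
  move=> Bx; have [_ sx cx] := hs x; exists (idx x) => //; split.
    by exists (s x); [split; [split; [exact: cx|exact: Bx]|exact: s1]|exact: sx].
  rewrite -bigcup_mkord => -[m /= mi [g [cg g1] gx]].
  by have [_ /(_ m mi)] := hidx x; apply; exists g.
move=> [n _ [[g [[cg Bg] g1] gx] nT]].
have nx : idx x = n.
  case: (ltngtP (idx x) n) => // lt.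
    exfalso; apply: nT; rewrite -bigcup_mkord; exists (idx x) => //.
    by have [_ sx cx] := hs x; exists (s x) => //; split; [exact: cx|exact: s1].
  by have [_ /(_ n lt)] := hidx x; case; exists g.
have [_ sx cx] := hs x; rewrite /preimage /=.
by rewrite (@chart_pi_inj _ _ n (s x) g) // ?sx // -nx.
Qed.

Variable mu : probability (X R d) R.
Hypothesis hmu : right_SL_invariant mu.

(** The exceptional null set may depend on [g]; exchanging these quantifiers is the task of
    [generic_point]. *)
Definition invariant_set (F : set (X R d)) :=
  forall g, \det g = 1 -> dist mu (act g @^-1` F) F = 0.

Variable s : X R d -> 'M[R]_d.
Hypothesis s1 : forall x, \det (s x) = 1.
Hypothesis sK : forall x, piX (s x) = x.
Hypothesis ms : mxent s.

Lemma mxent_lift c : mxent (fun p : (X R d * X R d)%type => s p.2 *m \adj (intm c *m s p.1)).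
Proof.
apply: mxent_mul; first by move=> i j; apply: (measurableT_comp (ms i j)).
apply: mxent_adj; apply: mxent_mul; first exact: mxent_cst.
by move=> i j; apply: (measurableT_comp (ms i j)).
Qed.

Lemma act_lift c x w : \det c = 1 ->
  act (\adj (intm c *m s w)) x = piX (s x *m \adj (intm c *m s w)).
Proof.
move=> c1; rewrite -{1}(sK x) act_pi // det_adj1 //.
by rewrite det_mul1 // det_intm.
Qed.

(* The lifts of [w] to SL(d,R) are the [c *m s w], so a condition on almost every [w] and
   every [c] replaces one on Haar-almost every element of SL(d,R). *)
Lemma generic_point (F : set (X R d)) : measurable F -> invariant_set F ->
  mu F != 0%E -> exists2 x, F x &
  forall c, \det c = 1 -> \forall w \ae mu, F (act (\adj (intm c *m s w)) x).
Proof.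
move=> mF iF F0.
pose G := [set g | \det g = 1 /\ F (piX g)].
have bG : borel_mx G by exact/measurable_XE.
(* In a pair, [p.1] is the point [w] whose lift acts and [p.2] is the point [x] acted on. For fixed
   [w] the bad [x] are null by invariance; Fubini makes the bad [w] null for almost every [x]. *)
pose Q c : set (X R d * X R d)%type :=
  [set p | F p.2 /\ ~ G (s p.2 *m \adj (intm c *m s p.1))].
have mQ c : measurable (Q c).
  apply: measurableI.
    by rewrite -[X in measurable X]setTI; exact: measurable_snd.
  apply: measurableC; exact: (mxent_borel (mxent_lift c)).
have det1c c w : \det c = 1 -> \det (\adj (intm c *m s w)) = 1.
  by move=> c1; rewrite det_adj1 // det_mul1 // det_intm.
have Q0 c y : \det c = 1 -> mu (xsection (Q c) y) = 0%E.
  move=> c1; have g1 := det1c c y c1.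
  rewrite prE; last exact: measurable_xsection.
  apply/eqP; rewrite eqe eq_le pr_ge0 andbT -(iF _ g1); apply: le_pr.
  - exact: measurable_xsection.
  - by apply: measurable_sdiff => //; exact: measurable_act.
  move=> x; rewrite /xsection /= inE => -[Fx nG]; right; split => //= Fa; apply: nG.
  by rewrite /G /= -act_lift // det_mul1.
(* There are countably many [c], so one [x] avoids the exceptional sets of all of them. *)
pose K n := if unpickle n is Some c then
  if \det c == 1 then Q c else set0 else (set0 : set (X R d * X R d)%type).
have KQ c : \det c = 1 -> K (pickle c) = Q c by move=> c1; rewrite /K pickleK c1 eqxx.
have : \forall x \ae mu, forall n, mu (ysection (K n) x) = 0%E.
  apply: ae_foralln => n.
  have [mK K0] : measurable (K n) /\ forall y, mu (xsection (K n) y) = 0%E.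
    rewrite /K; case: unpickle => [c|]; last first.
      by split => // y; rewrite xsection0 measure0.
    have [c1|_] := eqVneq (\det c) 1; last by split => // y; rewrite xsection0 measure0.
    by split => [|y]; [exact: mQ|exact: Q0].
  exact: fubini_null.
move=> [Z [mZ Z0 hZ]].
have [x Fx nZ] : exists2 x, F x & ~ Z x.
  apply: contrapT => h; move: F0; rewrite -measure_le0 -Z0 => /negP; apply.
  apply: le_measure; rewrite ?inE // => x Fx; apply: contrapT => nZ; apply: h.
  by exists x.
exists x => // c c1.
have /(_ (pickle c)) : forall n, mu (ysection (K n) x) = 0%E.
  by apply: contrapT => h; apply: nZ; apply: hZ.
rewrite KQ // => H; exists (ysection (Q c) x); split => //.
  exact: measurable_ysection.
move=> w /= nF; rewrite /ysection /= inE; split => //= -[_]; rewrite -act_lift //.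
Qed.

Lemma invariant_setC F : invariant_set F -> invariant_set (~` F).
Proof. by move=> iF g g1; rewrite preimage_setC distCC iF. Qed.

End Ergodicity.

Section NullOrConull.
Variables (R : realType) (d : nat).
Variable mu : probability (X R d) R.
Hypothesis hmu : right_SL_invariant mu.

Lemma ae_act (h : 'M[R]_d) (P : set (X R d)) : \det h = 1 ->
  (\forall w \ae mu, P w) -> \forall w \ae mu, P (act h w).
Proof.
move=> h1 [Z [mZ Z0 hZ]]; exists (act h @^-1` Z); split.
- exact: measurable_act.
- by rewrite mu_act.
- by move=> w /= nP; apply: hZ.
Qed.

(** Otherwise take generic points [x] of [E] and [z = act h x] of the complement. For almost every
    [w] the point [act (\adj (s w)) x] lies in [E]; it is also [act (\adj (s w *m h)) z], and
    [s w *m h] is a lift of [act h w], so it lies outside [E]. *)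
Lemma ergodicity (E : set (X R d)) : measurable E -> invariant_set mu E ->
  mu E = 0%E \/ mu (~` E) = 0%E.
Proof.
move=> mE iE; have [->|E0] := eqVneq (mu E) 0%E; first by left.
have [->|E0'] := eqVneq (mu (~` E)) 0%E; first by right.
have [s [s1 sK ms]] := measurable_section R d.
have [x Ex hx] := generic_point s1 sK ms mE iE E0.
have [z Ez hz] :=
  generic_point s1 sK ms (measurableC mE) (invariant_setC iE) E0'.
have [h h1 hxz] := act_trans x z.
(* The integer matrix between the two lifts of [act h w] varies with [w], so genericity for all [c]
   simultaneously is needed. *)
have /choice[c hc] w : exists c : 'M[int]_d,
    \det c = 1 /\ s w *m h = map_mx intr c *m s (act h w).
  have : piX (s (act h w)) = piX (s w *m h) by rewrite sK -act_pi ?sK.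
  by move=> /(pi_inj (s1 _) (det_mul1 (s1 _) h1))[c c1 e]; exists c.
have Hx : \forall w \ae mu, E (act (\adj (s w)) x).
  have := hx 1%:M (det1 _ _); apply: filterS => w.
  by rewrite map_mx1 mul1mx.
have Hz : \forall w \ae mu, forall n, if unpickle n is Some a then
    \det a = 1 -> ~ E (act (\adj (map_mx intr a *m s w)) z) else True.
  apply: ae_foralln => n; case: unpickle => [a|]; last by apply: filterE.
  have [a1|a1] := eqVneq (\det a) 1; last by apply: filterE => w /eqP; rewrite (negbTE a1).
  by have := hz _ a1; apply: filterS.
have [Z [mZ Z0 hZ]] : \forall w \ae mu, False.
  have := ae_act h1 Hz; apply: filter_app; move: Hx; apply: filterS => w Ew.
  move=> /(_ (pickle (c w))); rewrite pickleK; have [c1 <-] := hc w => /(_ c1).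
  apply; have sh1 := det_mul1 (s1 w) h1.
  have -> : z = act (s w *m h) (act (\adj (s w)) x).
    by rewrite -act_comp // act_Kadj.
  by rewrite act_adjK.
have : (mu setT <= 0)%E by rewrite -Z0; apply: le_measure; rewrite ?inE // => w _; exact: hZ.
by rewrite probability_setT lee_fin ler10.
Qed.

End NullOrConull.

(** * Mixing *)

Section DominatedContent.
Context d (T : measurableType d) (R : realType) (mu : probability T R).
Variable f : set T -> R.
Hypothesis f_ge0 : forall A, measurable A -> 0 <= f A.
Hypothesis f_add : forall A B, measurable A -> measurable B -> A `&` B = set0 ->
  f (A `|` B) = f A + f B.
Hypothesis f_le : forall A, measurable A -> f A <= pr mu A.

(** A measure is a total function on sets, while [f] is controlled on measurable ones only; 0 is a
    harmless value elsewhere. *)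
Let nu (A : set T) : \bar R := if pselect (measurable A) then (f A)%:E else 0%E.

Let nuE A : measurable A -> nu A = (f A)%:E.
Proof. by move=> mA; rewrite /nu; case: pselect. Qed.

Lemma content_set0 : f set0 = 0.
Proof.
have := @f_add set0 set0 measurable0 measurable0 (setI0 _).
by rewrite setU0 => /eqP; rewrite -subr_eq0 opprD addrA subrr sub0r oppr_eq0 => /eqP.
Qed.

Let nu0 : nu set0 = 0%E.
Proof. by rewrite nuE // content_set0. Qed.

Let nu_ge0 A : (0 <= nu A)%E.
Proof. by rewrite /nu; case: pselect => // mA; rewrite lee_fin f_ge0. Qed.

(** Finite additivity leaves the tail of the union as the error, and [f] of the tail is at most its
    [mu]-measure, which tends to 0. *)
Let nu_sigma_additive : semi_sigma_additive nu.
Proof.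
move=> F mF tF mU.
have mB n : measurable (\big[setU/set0]_(i < n) F i) by exact: bigsetU_measurable.
have dB n : \big[setU/set0]_(i < n) F i `&` F n = set0.
  apply/seteqP; split => // x [+ Fn]; rewrite -bigcup_mkord => -[i /= ilt Fi].
  by have := tF i n I I (ex_intro _ x (conj Fi Fn)) => e; rewrite e ltnn in ilt.
have fB n : f (\big[setU/set0]_(i < n) F i) = \sum_(i < n) f (F i).
  elim: n => [|n IH]; first by rewrite !big_ord0 content_set0.
  by rewrite !big_ord_recr /= (f_add (mB n) (mF n) (dB n)) IH.
rewrite nuE //.
rewrite (_ : (fun n => _) = (fun n => (f (\big[setU/set0]_(i < n) F i))%:E)); last first.
  apply/funext => n; rewrite fB big_mkord -sumEFin.
  by apply: eq_bigr => i _; rewrite nuE.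
apply: cvg_EFin; first exact: nearW.
have fD n : f (\bigcup_i F i) - f (\big[setU/set0]_(i < n) F i) =
    f ((\bigcup_i F i) `\` \big[setU/set0]_(i < n) F i).
  apply/eqP; rewrite subr_eq -f_add //; first last.
  - by apply/seteqP; split => // x [[]].
  - exact: measurableD.
  rewrite setUC setDUK //; exact: bigsetU_bigcup.
apply/cvgrPdist_le => e e0.
have /cvgrPdist_le/(_ e e0) := cvg_pr_bigcup mu mF.
apply: filterS => n; rewrite sub0r normrN ger0_norm ?pr_ge0 // => le_e.
have mD : measurable (\bigcup_i F i `\` \big[setU/set0]_(i < n) F i) by exact: measurableD.
by rewrite /= fD ger0_norm ?f_ge0 //; apply: le_trans le_e; exact: f_le.
Qed.

HB.instance Definition _ := isMeasure.Build d T R nu nu0 nu_ge0 nu_sigma_additive.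

Let nu_fin : fin_num_fun nu.
Proof. by move=> A mA; rewrite nuE. Qed.

HB.instance Definition _ := Measure_isFinite.Build d T R nu nu_fin.

Lemma content_density : exists phi : T -> \bar R,
  mu.-integrable setT phi /\ forall A, measurable A -> (f A)%:E = (\int[mu]_(x in A) phi x)%E.
Proof.
have numu : (nu : {measure set T -> \bar R}) `<< mu.
  apply/null_content_dominatesP => A mA A0; rewrite /= nuE //.
  by apply/eqP; rewrite eqe eq_le f_ge0 // andbT -(pr_set0 mu) /pr measure0 -A0 f_le.
have [phi [_ _ iphi phiE]] := radon_nikodym_sigma_finite numu.
by exists phi; split => // A mA; rewrite -phiE //= nuE.
Qed.

End DominatedContent.

Section ConstantDensity.
Context d (T : measurableType d) (R : realType) (mu : probability T R).
Variables (f : set T -> R) (phi : T -> \bar R).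
Hypothesis iphi : mu.-integrable setT phi.
Hypothesis phiE : forall A, measurable A -> (f A)%:E = (\int[mu]_(x in A) phi x)%E.

Lemma integral_cst_pr c A : measurable A ->
  (\int[mu]_(x in A) cst c%:E x = (c * pr mu A)%:E)%E.
Proof. by move=> mA; rewrite integral_cst // EFinM; congr (_ * _)%E; exact: prE. Qed.

(** On [A] the function [phi - c] is positive, yet its integral is at most 0. *)
Lemma superlevel_null c A : measurable A -> (forall x, A x -> (c%:E < phi x)%E) ->
  f A <= c * pr mu A -> mu A = 0%E.
Proof.
move=> mA cphi fA.
have iA : mu.-integrable A phi by exact: integrableS iphi.
have ic : mu.-integrable A (cst c%:E).
  by apply: finite_measure_integrable_cst.
have mphi : measurable_fun A (fun x => phi x - c%:E)%E.
  apply: emeasurable_funB; [exact: measurable_int iA|exact: measurable_cst].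
have : (\int[mu]_(x in A) `|phi x - c%:E| = 0)%E.
  apply/eqP; rewrite eq_le integral_ge0 // andbT.
  under eq_integral => x /[!inE] Ax do rewrite gee0_abs ?sube_ge0 ?ltW ?cphi //.
  by rewrite integralB // -phiE // integral_cst_pr // -EFinB lee_fin subr_le0.
move/(ae_eq_integral_abs mu mA mphi) => [Z [mZ Z0 hZ]].
apply/eqP; rewrite -measure_le0 -Z0; apply: le_measure; rewrite ?inE //.
move=> x Ax; apply: hZ => /= /(_ Ax) e.
by have := cphi _ Ax; rewrite -sube_gt0 e ltxx.
Qed.

Lemma sublevel_le c A : measurable A -> (forall x, A x -> (phi x <= c%:E)%E) ->
  f A <= c * pr mu A.
Proof.
move=> mA cphi; rewrite -lee_fin phiE // -integral_cst_pr //.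
apply: le_integral => //; first exact: integrableS iphi.
by apply: finite_measure_integrable_cst.
by move=> x /[!inE]; exact: cphi.
Qed.

Lemma superlevel_ge c A : measurable A -> (forall x, A x -> (c%:E <= phi x)%E) ->
  c * pr mu A <= f A.
Proof.
move=> mA cphi; rewrite -lee_fin phiE // -integral_cst_pr //.
apply: le_integral => //; last by move=> x /[!inE]; exact: cphi.
  by apply: finite_measure_integrable_cst.
exact: integrableS iphi.
Qed.

End ConstantDensity.

Section Mixing.
Variables (R : realType) (d : nat).
Variable mu : probability (X R d) R.
Hypothesis hmu : right_SL_invariant mu.
Variable a : nat -> 'M[R]_d.
Hypothesis a1 : forall n, \det (a n) = 1.
Variable I : pred 'I_d.
Hypothesis exI : exists i, I i.
Hypothesis exJ : exists j, ~~ I j.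
Hypothesis contr : forall i j s, I i -> ~~ I j ->
  mxcvg \oo (fun n => \adj (a n) *m elem i j s *m a n) 1%:M.
Variable B : set (X R d).
Hypothesis mB : measurable B.
Implicit Types (A : set (X R d)) (U : set_system nat).

Let mact g A : \det g = 1 -> measurable A -> measurable (act g @^-1` A).
Proof. exact: measurable_act. Qed.

Let corr A n : R := pr mu (A `&` act (a n) @^-1` B).

Let mcorr A n : measurable A -> measurable (A `&` act (a n) @^-1` B).
Proof. by move=> mA; apply: measurableI => //; exact: mact. Qed.

(** Compactness gives a cluster point. It is a limit, because an ultrafilter contains either the
    preimage of a neighbourhood or its complement, and the latter contradicts clustering. *)
Lemma ultra_cvg_bounded U (u : nat -> R) : UltraFilter U ->
  (forall n, 0 <= u n <= 1) -> exists l : R, u @ U --> l.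
Proof.
move=> UU u01.
have cpt : compact (`[0, 1]%classic : set R) by exact: segment_compact.
have [|l [_ cl]] := cpt (u @ U) _.
  by apply: (@filterE _ U) => n; rewrite /= in_itv /=; exact: u01.
exists l => V lV; have [//|nV] := in_ultra_setVsetC (u @^-1` V) UU.
have [y [nVy Vy]] := cl (~` V) V nV lV.
by case: nVy.
Qed.

Section Ultralimit.
Variable U : set_system nat.
Hypothesis UU : UltraFilter U.
Hypothesis ooU : \oo `<=` U.

Lemma ultra_sub (u : nat -> R) (l : R) : u @ \oo --> l -> u @ U --> l.
Proof. by move=> ul V lV; apply: ooU; exact: ul. Qed.

Let f A := lim (corr A @ U).

Let corr_cvg A : measurable A -> corr A @ U --> f A.
Proof.
move=> mA; have [n|l] := @ultra_cvg_bounded U (corr A) UU.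
  by rewrite pr_ge0 pr_le1 //; exact: mcorr.
by move=> cl; rewrite /f (cvg_lim (@Rhausdorff R) cl).
Qed.

Let fE A (l : R) : corr A @ U --> l -> f A = l.
Proof. by move=> cl; rewrite /f (cvg_lim (@Rhausdorff R) cl). Qed.

Let f_ge0 A : measurable A -> 0 <= f A.
Proof.
move=> mA; apply: limr_ge; first by apply/cvg_ex; exists (f A); exact: corr_cvg.
by apply: nearW => n; exact: pr_ge0.
Qed.

Let f_le A : measurable A -> f A <= pr mu A.
Proof.
move=> mA; apply: limr_le; first by apply/cvg_ex; exists (f A); exact: corr_cvg.
by apply: nearW => n; apply: le_pr => //; exact: mcorr.
Qed.

Let f_add A C : measurable A -> measurable C -> A `&` C = set0 -> f (A `|` C) = f A + f C.
Proof.
move=> mA mC AC; apply: fE.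
rewrite (_ : corr _ = fun n => corr A n + corr C n).
  by apply: cvgD; exact: corr_cvg.
apply/funext => n; rewrite /corr setIUl pr_setU //; [exact: mcorr..|].
by apply/seteqP; split => // x [[Ax _] [Cx _]]; rewrite -AC.
Qed.

Let f_setT : f setT = pr mu B.
Proof.
apply: fE; rewrite (_ : corr _ = cst (pr mu B)); first exact: cvg_cst.
by apply/funext => n; rewrite /corr setTI pr_act.
Qed.

(* [act g^-1 A] meets [act (a n)^-1 B] as much as [A] meets [act (a n)^-1 B'], where [B'] is
   [B] translated by the conjugate of [g^-1] by [a n], which tends to the identity. *)
Let f_elem A i j s : I i -> ~~ I j -> measurable A ->
  f (act (elem i j s) @^-1` A) = f A.
Proof.
move=> Ii Ij mA; have ij : i != j by apply: contraNneq Ij => <-.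
have e1 t : \det (elem i j t : 'M[R]_d) = 1 by exact: det_elem.
pose h n := \adj (a n) *m elem i j (- s) *m a n.
have h1 n : \det (h n) = 1 by rewrite !det_mul1 ?det_adj1.
have [_ hB] := measurable_L1cont hmu h1 (contr (- s) Ii Ij) mB.
have mA' : measurable (act (elem i j s) @^-1` A) by exact: mact.
have cE n : corr (act (elem i j s) @^-1` A) n =
    pr mu (A `&` act (a n) @^-1` (act (h n) @^-1` B)).
  have mI := @mcorr (act (elem i j s) @^-1` A) n mA'.
  rewrite /corr -(pr_act hmu (e1 (- s)) mI); congr (pr mu _).
  apply/seteqP; split => x /=; rewrite !act_comp // ?elem_mul // ?addNr ?elem0 ?act1 /h;
    by rewrite !mulmxA mulmx_adj1 // mul1mx.
apply: fE; rewrite -[X in _ --> X]addr0.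
rewrite (_ : corr _ = fun n => corr A n + (corr (act (elem i j s) @^-1` A) n - corr A n)).
  apply: cvgD; first exact: corr_cvg.
  apply: ultra_sub; apply/cvgr0Pnorm_le => e e0.
  have /cvgr0Pnorm_le/(_ e e0) := hB; apply: filterS => n.
  rewrite (ger0_norm (pr_ge0 _ _)) => le_e.
  apply: (@le_trans _ _ (dist mu (act (h n) @^-1` B) B)); last exact: le_e.
  have mh : measurable (act (h n) @^-1` B) by exact: mact.
  rewrite cE -(dist_act hmu (a1 n) mh mB).
  apply: le_trans (ler_dist_pr mu _ _) (dist_setIr mu _ _ mA);
    by try apply: measurableI => //; exact: mact.
by apply/funext => n; rewrite addrC subrK.
Qed.

(** A single superlevel set suffices, at the mean value [c] of the density. If it were conull, then
    [f E = c * pr mu E] and [superlevel_null] would make it null all the same. So [phi <= c] almost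
    everywhere, and a function bounded by its mean is constant. *)
Lemma ultra_mixing A : measurable A -> corr A @ U --> pr mu A * pr mu B.
Proof.
move=> mA; suff fAE : f A = pr mu A * pr mu B by rewrite -fAE; exact: corr_cvg.
have [phi [iphi phiE]] := content_density f_ge0 f_add f_le.
pose c := pr mu B; pose E : set (X R d) := [set x | (c%:E < phi x)%E].
have mE : measurable E.
  rewrite -[E]setTI; apply: emeasurable_fun_o_infty => //; exact: measurable_int iphi.
have invE : invariant_set mu E.
  apply: (len_SL hmu mE exI exJ) => i j s Ii Ij.
  have ij : i != j by apply: contraNneq Ij => <-.
  have e1 t : \det (elem i j t : 'M[R]_d) = 1 by exact: det_elem.
  have mE' : measurable (act (elem i j s) @^-1` E) by exact: mact.
  rewrite dist_diff ?pr_act //.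
  (* [C] is the part of [E] that the translation moves out of [E]. On it [phi > c], but its
     translate has the same [f] and [mu] and lies where [phi <= c], which forces [C] to be null. *)
  set C := E `\` _; have mC : measurable C by exact: measurableD.
  have mC' : measurable (act (elem i j (- s)) @^-1` C) by exact: mact.
  rewrite /pr (superlevel_null iphi phiE mC (c := c)) ?mul0rn //; first by move=> x [].
  rewrite -(f_elem (- s) Ii Ij mC) -(pr_act hmu (e1 (- s)) mC).
  apply: (sublevel_le iphi phiE) => // x [_ /= nE]; rewrite leNgt; apply/negP => Ex.
  by apply: nE; rewrite act_comp // elem_mul // addNr elem0 act1.
have split_f C : measurable C -> f C = f (C `&` E) + f (C `\` E).
  move=> mC; rewrite -f_add ?setUIDK //; [exact: measurableI|exact: measurableD|].
  by apply/seteqP; split => // x [[_ ?] []].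
have f_null C : measurable C -> mu C = 0%E -> f C = 0.
  by move=> mC C0; apply/eqP; rewrite eq_le f_ge0 // andbT (le_trans (f_le mC)) // /pr C0.
have E0 : mu E = 0%E.
  have [//|nE0] := ergodicity hmu mE invE.
  apply: (superlevel_null iphi phiE mE (c := c)) => //.
  have prE1 : pr mu E = 1.
    by have := pr_setC mu mE; rewrite {1}/pr nE0 /= => /esym/subr0_eq.
  rewrite prE1 mulr1 /c -f_setT (split_f _ measurableT) setTI setTD.
  by rewrite (f_null (~` E)) ?addr0 //; exact: measurableC.
have f_le_c C : measurable C -> f C <= c * pr mu C.
  move=> mC; rewrite split_f // f_null ?add0r; first last.
  - by apply: (subset_measure0 (B := E)) => //; exact: measurableI.
  - exact: measurableI.
  apply: (@le_trans _ _ (c * pr mu (C `\` E))).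
    apply: (sublevel_le iphi phiE) => [|x [_ /negP]]; first exact: measurableD.
    by rewrite -leNgt.
  by rewrite ler_wpM2l ?pr_ge0 //; apply: le_pr => //; exact: measurableD.
(* The upper bounds for [A] and its complement add up to the exact total [c], so neither can be
   strict. *)
apply/eqP; rewrite mulrC eq_le f_le_c //=.
have := f_le_c _ (measurableC mA); rewrite pr_setC //.
have := f_setT; rewrite -(setUv A) (f_add mA (measurableC mA) (setICr A)).
rewrite -/c; lra.
Qed.

End Ultralimit.

(** If convergence failed, the indices [S] with a gap of at least [e] would meet every neighbourhood
    of infinity; an ultrafilter refining [\oo] and containing [S] contradicts [ultra_mixing]. *)
Lemma mixing A : measurable A ->
  (fun n => pr mu (A `&` act (a n) @^-1` B)) @ \oo --> pr mu A * pr mu B.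
Proof.
move=> mA; apply/cvgrPdist_lt => e e0; apply: contrapT => bad.
pose S := [set n | ~ `|pr mu A * pr mu B - corr A n| < e].
have PF : ProperFilter (within S \oo).
  apply: Build_ProperFilter_ex => V VS; apply: contrapT => nV; apply: bad.
  have {}VS : \forall n \near \oo, S n -> V n by exact: VS.
  near=> n; apply: contrapT => Sn; apply: nV; exists n.
  by move: Sn; near: n.
have [U [UU SU]] := ultraFilterLemma PF.
have ooU : \oo `<=` U.
  by move=> V ooV; apply: SU; apply: filterS ooV => n Vn _.
have US : U S by apply: SU; exact: withinT.
have /cvgrPdist_lt/(_ e e0) Ulim := ultra_mixing UU ooU mA.
have [n [Sn ]] := filter_ex (filterI US Ulim).
exact: Sn.
Unshelve. all: by end_near. Qed.

End Mixing.

(** * From mixing for mu to laws absolutely continuous with respect to mu *)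

Section AbsoluteContinuity.
Context d (T : measurableType d) (R : realType) (mu lam : probability T R).
Hypothesis lam_mu : lam `<< mu.
Variables (C : nat -> set T) (c : R).
Hypothesis mC : forall n, measurable (C n).
Hypothesis c01 : 0 <= c <= 1.
Hypothesis mixC : forall A, measurable A ->
  (fun n => pr mu (A `&` C n)) @ \oo --> pr mu A * c.

(* Slicing a density of [lam] into layers of height [e] makes [lam] comparable with a
   multiple of [mu] on each layer. *)
Lemma mixing_dominated : (fun n => pr lam (C n)) @ \oo --> c.
Proof.
have [phi [phi0 phifin iphi phiE0]] := radon_nikodym_sigma_finite lam_mu.
have phiE A : measurable A -> (pr lam A)%:E = (\int[mu]_(x in A) phi x)%E.
  by move=> mA; rewrite -phiE0 // -prE.
have mphi : measurable_fun setT phi := measurable_int mu iphi.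
have mI A n : measurable A -> measurable (A `&` C n) by move=> mA; exact: measurableI.
(* The final error is at most [3 * e]: [2 * e] from the layers and [e] from the tail. The factor 8
   is not sharp. *)
apply/cvgrPdist_le => e0 e00; pose e := e0 / 8.
have e_gt0 : 0 < e by rewrite divr_gt0.
pose S k : set T := [set x | (phi x < (k%:R * e)%:E)%E].
have mS k : measurable (S k).
  by rewrite -[S k]setTI; apply: emeasurable_fun_infty_o.
have S_le k l : (k <= l)%N -> S k `<=` S l.
  move=> kl x /= /lt_le_trans; apply; rewrite lee_fin.
  by rewrite (ler_wpM2r (ltW e_gt0)) // ler_nat.
(* Two kinds of error: [e] times the mass of each layer, which sums to at most [e] whatever [k] is,
   and [dl], which is halved at each layer and absorbed by the convergence of mixing. *)
have key k dl : 0 < dl -> \forall n \near \oo,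
    `|c * pr lam (S k) - pr lam (S k `&` C n)| <= e * pr mu (S k) + dl.
  elim: k dl => [|k IH] dl dl0.
    apply: nearW => n; have -> : S 0%N = set0.
      by apply/seteqP; split => // x; rewrite /S /= mulr0n mul0r ltNge phi0.
    by rewrite set0I !pr_set0 !mulr0 subr0 normr0 add0r ltW.
  pose A := S k.+1 `\` S k; pose a := k%:R * e.
  have mA : measurable A by exact: measurableD.
  have a0 : 0 <= a by rewrite mulr_ge0 // ltW.
  have SA : S k.+1 = S k `|` A by rewrite setDUK //; exact: S_le.
  have SA0 : S k `&` A = set0 by apply/seteqP; split => // x [? []].
  have phiA x : A x -> (a%:E <= phi x)%E /\ (phi x <= (a + e)%:E)%E.
    rewrite /A /S /= -[X in (_ < (X * _)%:E)%E]natr1 mulrDl mul1r => -[/ltW ? /negP].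
    by rewrite -leNgt.
  have bnd D : measurable D -> D `<=` A ->
      a * pr mu D <= pr lam D /\ pr lam D <= a * pr mu D + e * pr mu D.
    move=> mD DA; rewrite -mulrDl; split.
      by apply: (superlevel_ge iphi phiE) => // x /DA/phiA[].
    by apply: (sublevel_le iphi phiE) => // x /DA/phiA[].
  have dl2 : 0 < dl / 2 by rewrite divr_gt0.
  (* On the lowest layer [a] is 0, hence the divisor [a + 1]. *)
  have eta0 : 0 < dl / 2 / (a + 1) by rewrite divr_gt0 // ltr_wpDl.
  have /cvgrPdist_le/(_ _ eta0) := mixC mA.
  apply: filter_app; have := IH _ dl2; apply: filterS => n hk hA.
  have mAC := mI A n mA.
  have [y1 y2] := bnd A mA (@subset_refl _ A).
  have [z1 z2] := bnd _ mAC (@subIsetl _ A (C n)).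
  have xx : pr mu (A `&` C n) <= pr mu A by apply: le_pr.
  rewrite SA setIUl !pr_setU //; last 2 first.
  - exact: mI.
  - by apply/seteqP; split => // x [[? _] [[] //]].
  have e1 : a * `|pr mu A * c - pr mu (A `&` C n)| <= dl / 2.
    apply: le_trans (ler_wpM2l a0 hA) _; rewrite mulrA ler_pdivrMr ?ltr_wpDl //.
    by rewrite mulrDr mulr1 mulrC lerDl ltW.
  have {hA e1} [e1 e2] : a * (pr mu A * c) - a * pr mu (A `&` C n) <= dl / 2 /\
      a * pr mu (A `&` C n) - a * (pr mu A * c) <= dl / 2.
    rewrite -!mulrBr; split; apply: le_trans e1; apply: ler_wpM2l => //.
      exact: ler_norm.
    by rewrite distrC ler_norm.
  have c0 : 0 <= c by case/andP: c01.
  have w1 := ler_wpM2l c0 y1; have w2 := ler_wpM2l c0 y2.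
  have w3 : c * (e * pr mu A) <= e * pr mu A.
    by apply: ler_piMl; [rewrite mulr_ge0 ?pr_ge0 // ltW|case/andP: c01].
  have w4 := ler_wpM2l (ltW e_gt0) xx.
  move: hk; rewrite !ler_norml => /andP[h1 h2].
  move: y1 y2 z1 z2 e1 e2 w1 w2 w3 w4 h1 h2.
  rewrite !mulrDr (mulrCA c a) [c * pr mu A]mulrC.
  move: (a * _) (a * (_ * c)) (a * _) => ? ? ?.
  by move=> *; apply/andP; split; lra.
(* The density may be unbounded but is finite everywhere, so the sets [S k] exhaust the space. *)
have [k kS] : exists k, pr lam (~` S k) <= e.
  have : (fun n => pr lam (~` S n)) @ \oo --> (0 : R).
    apply: cvg_pr_decr.
    - by move=> n; exact: measurableC.
    - by move=> k l kl; apply: subsetC; exact: S_le.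
    - rewrite -setC_bigcup -setCT; congr (~` _); apply/seteqP; split => // x _.
      have [k hk] : exists k : nat, fine (phi x) / e < k%:R.
        by exists (Num.truncn (fine (phi x) / e)).+1; rewrite truncnS_gt.
      by exists k => //; rewrite /S /= -(fineK (phifin x)) lte_fin -ltr_pdivrMr.
  move=> /cvgrPdist_le/(_ e e_gt0)[k _ /(_ k (leqnn _))] /=.
  by rewrite sub0r normrN ger0_norm ?pr_ge0 // => h; exists k.
near=> n.
have lS : pr lam (S k) = 1 - pr lam (~` S k) by rewrite -pr_setC ?setCK //; exact: measurableC.
have lC : pr lam (C n) = pr lam (S k `&` C n) + pr lam (C n `\` S k).
  by rewrite (pr_split lam (mC n) (mS k)) setIC.
have lD : 0 <= pr lam (C n `\` S k) <= pr lam (~` S k).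
  rewrite pr_ge0; apply: le_pr; [exact: measurableD|exact: measurableC|].
  by move=> x [].
have mu1 : pr mu (S k) <= 1 by exact: pr_le1.
have t0 : 0 <= pr lam (~` S k) by exact: pr_ge0.
have c0 : 0 <= c by case/andP: c01.
have ct : 0 <= c * pr lam (~` S k) <= pr lam (~` S k).
  by rewrite mulr_ge0 //= ler_piMl //; case/andP: c01.
have em : e * pr mu (S k) <= e by rewrite ler_piMr // ltW.
have : `|c * pr lam (S k) - pr lam (S k `&` C n)| <= e * pr mu (S k) + e.
  by near: n; exact: key.
move: ct lD em; rewrite lC lS mulrBr mulr1 !ler_norml.
move: (c * _) (e * pr mu _) => ct em /andP[? ?] /andP[? ?] ? /andP[? ?].
have ee : e0 = 8 * e by rewrite /e mulrC divfK.
by apply/andP; split; lra.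
Unshelve. all: by end_near. Qed.

End AbsoluteContinuity.

(** * Hits and dilations *)

(** Inversion is continuous away from 0, and a single point is always measurable. *)
Lemma measurable_invr (R : realType) : measurable_fun setT (fun x : R => x^-1).
Proof.
rewrite -(setvU [set 0]); apply/measurable_funU => //; first exact: measurableC.
split; last exact: measurable_fun_set1.
apply: open_continuous_measurable_fun.
  by apply: closed_openC; exact: closed_eq.
by move=> x; rewrite inE /= => /eqP x0; exact: inv_continuous.
Qed.

Section HitSets.
Variables (R : realType) (k m : nat).
Variable W : set 'rV[R]_(m.+1).
Implicit Types (x : X R (k + m.+1)) (A : set 'rV[R]_k).

Notation intm := (map_mx (intr : int -> R)).

Definition dilation (L : R) : 'M[R]_(k + m.+1) :=
  block_mx (L `^ (- (m.+1%:R / k%:R)))%:M 0 0 L%:M.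

Lemma mul_dilation L v : v *m dilation L =
  row_mx (L `^ (- (m.+1%:R / k%:R)) *: lsubmx v) (L *: rsubmx v) :> 'rV_(k + m.+1).
Proof.
rewrite -{1}[v]hsubmxK /dilation mul_row_block !mulmx0 addr0 add0r.
by rewrite !mul_mx_scalar.
Qed.

Lemma det_dilation L : (0 < k)%N -> 0 < L -> \det (dilation L) = 1.
Proof.
move=> k0 L0; rewrite /dilation det_ublock !det_scalar -powR_mulrn ?powR_ge0 //.
rewrite -powRrM mulNr divfK ?pnatr_eq0 -?lt0n // powRN powR_mulrn ?ltW //.
by rewrite mulVf // expf_neq0 // gt_eqF.
Qed.

(** The origin of the normalisation [L^(-n/k)]: the numerator scales by [L^(-(m+1)/k)], the
    denominator by [L], and [(m+1)/k + 1 = n/k]. *)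
Lemma xi_dilation L v : (0 < k)%N -> 0 < L ->
  xi (v *m dilation L) = L `^ (- ((k + m.+1)%:R / k%:R)) *: xi v.
Proof.
move=> k0 L0; rewrite /xi /ylast mul_dilation row_mxKl row_mxKr mxE !scalerA; congr (_ *: _).
have -> : (k + m.+1)%:R / k%:R = m.+1%:R / k%:R + 1 :> R.
  by rewrite natrD addrC mulrDl divff // pnatr_eq0 -lt0n.
rewrite opprD powRD; last by apply/implyP => _; rewrite gt_eqF.
by rewrite powR_inv1 ?ltW // invfM mulrC mulrA.
Qed.

Lemma primX_act (h : 'M[R]_(k + m.+1)) x : \det h = 1 ->
  primX (act h x) = [set v *m h | v in primX x].
Proof.
move=> h1; have [g g1 ->] := pi_surj x.
rewrite act_pi // !primX_pi ?det_mul1 //; apply/seteqP; split => v /=.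
  by move=> [z z1 <-]; exists (intm z *m g); [exists z|rewrite mulmxA].
by move=> [w [z z1 <-] <-]; exists z => //; rewrite mulmxA.
Qed.

Lemma hit_set_dilation L x A : (0 < k)%N -> 0 < L ->
  (hit_set W x L (L `^ (- ((k + m.+1)%:R / k%:R))) A #=
   hit_set W (act (dilation L) x) 1 1 A)%card.
Proof.
move=> k0 L0; have D1 := det_dilation k0 L0.
rewrite (_ : hit_set W (act _ _) 1 1 A =
    [set v *m dilation L | v in hit_set W x L (L `^ (- ((k + m.+1)%:R / k%:R))) A]).
  apply: card_esym; apply: inj_card_eq => v w _ _ vw.
  by rewrite -[v]mulmx1 -(mulmx_adj1 D1) mulmxA vw -mulmxA mulmx_adj1 // mulmx1.
rewrite /hit_set /hit_index primX_act //; apply/seteqP; split => v /=.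
  move=> [[[w pw <-]]]; rewrite !scale1r {1}mul_dilation row_mxKr xi_dilation // => Ww Aw.
  by exists w.
move=> [w [[pw Ww] Aw] <-]; rewrite !scale1r {2}mul_dilation row_mxKr xi_dilation //.
by split => //; split => //; exists w.
Qed.

Lemma borel_cone A : borel_mx W -> borel_mx A ->
  borel_mx [set v : 'rV[R]_(k + m.+1) | W (rsubmx v) /\ A (xi v)].
Proof.
move=> bW bA; rewrite borel_mxE; apply: measurableI.
  apply: (@borel_preimage _ _ _ _ _ (fun v : 'rV[R]_(k + m.+1) => rsubmx v)) bW => i j.
  rewrite (_ : (fun _ => _) = fun v : 'rV[R]_(k + m.+1) => v i (rshift k j)).
    exact: mxent_id.
  by apply/funext => v; rewrite mxE.
apply: (@borel_preimage _ _ _ _ _ (@xi R k m)) bA => i j.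
rewrite (_ : (fun _ => _) = fun v : 'rV[R]_(k + m.+1) =>
    (v ord0 (rshift k ord_max))^-1 * v i (lshift m.+1 j)).
  apply: measurable_funM; last exact: mxent_id.
  exact: (measurableT_comp (@measurable_invr R)
    (@mxent_id R 1 (k + m.+1) ord0 (rshift k ord_max))).
by apply/funext => v; rewrite /xi /ylast !mxE.
Qed.

(** Indexing the hits by integer vectors replaces a set that moves with [g] by conditions on a fixed
    countable set, as measurability in [g] requires. *)
Lemma hit_set_pi g A : \det g = 1 ->
  (hit_set W (piX g) 1 1 A #= [set z : 'rV[int]_(k + m.+1) | gcd_row z = 1 /\
    W (rsubmx (intm z *m g)) /\ A (xi (intm z *m g))])%card.
Proof.
move=> g1.
rewrite (_ : hit_set _ _ _ _ _ = [set intm z *m g | z in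
   [set z : 'rV[int]_(k + m.+1) | gcd_row z = 1 /\
    W (rsubmx (intm z *m g)) /\ A (xi (intm z *m g))]]).
  apply: inj_card_eq => y z _ _ yz; have : intm y = intm z.
    by rewrite -[intm y]mulmx1 -(mulmx_adj1 g1) mulmxA yz -mulmxA mulmx_adj1 // mulmx1.
  by move/matrixP => e; apply/matrixP => i j; have := e i j; rewrite !mxE => /intr_inj.
rewrite /hit_set /hit_index primX_pi //; apply/seteqP; split => v /=.
  by move=> [[[z z1 <-]]]; rewrite !scale1r => ? ?; exists z.
by move=> [z [z1 [Wz Az]] <-]; rewrite !scale1r; split => //; split => //; exists z.
Qed.

(** A finite set of hits is listed by some sequence [s] of integer vectors. There are countably many
    [s], and that the hits are exactly those in [s] is a countable intersection of Borel conditions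
    on [g]. *)
Lemma measurable_hit A N : borel_mx W -> borel_mx A ->
  measurable [set x : X R (k + m.+1) | (hit_set W x 1 1 A #= `I_N)%card].
Proof.
move=> bW bA; apply/measurable_XE.
pose C := [set v : 'rV[R]_(k + m.+1) | W (rsubmx v) /\ A (xi v)].
have bC : borel_mx C by exact: borel_cone.
pose Z g := [set z : 'rV[int]_(k + m.+1) | gcd_row z = 1 /\ C (intm z *m g)].
rewrite (_ : [set _ | _] = [set g | \det g = 1] `&`
    \bigcup_(s in [set s : seq 'rV[int]_(k + m.+1) | ([set` s] #= `I_N)%card])
      \bigcap_(z in [set: 'rV[int]_(k + m.+1)]) [set g | Z g z <-> z \in s]).
  rewrite borel_mxE; apply: measurableI; first exact: (@borel_det1 R _).
  rewrite bigcup_mkcond; apply: countable_bigcupT_measurable => [|s]; first exact: countableP.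
  case: ifP => // _; rewrite -[X in measurable X]setCK setC_bigcap; apply: measurableC.
  apply: countable_bigcupT_measurable => [|z]; first exact: countableP.
  apply: measurableC.
  have mZ : borel_mx [set g | Z g z].
    have [z1|z1] := pselect (gcd_row z = 1); last first.
      rewrite (_ : [set _ | _] = set0); first by rewrite borel_mxE.
      by apply/seteqP; split => // g [].
    rewrite (_ : [set _ | _] = [set g | C (intm z *m g)]).
      exact: (borel_mull _ bC).
    by apply/seteqP; split => // g [].
  have [zs|zs] := boolP (z \in s).
    rewrite (_ : [set _ | _] = [set g | Z g z]); first exact: mZ.
    by apply/seteqP; split => g; [move=> [_]; apply|move=> Zg; split].
  rewrite (_ : [set _ | _] = ~` [set g | Z g z]); first exact: measurableC.
  by apply/seteqP; split => g /=; [move=> h /h|move=> nZ; split => // /nZ].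
apply/seteqP; split => g /=.
  move=> [g1 /(card_eq_trans (card_esym (hit_set_pi A g1))) cZ]; split => //.
  have /finite_seqP[s sZ] : finite_set (Z g) by apply/finite_setP; exists N.
  exists s; first by rewrite /= -sZ.
  by move=> z _ /=; rewrite sZ.
move=> [g1 [s sN sZ]]; split => //; apply: card_eq_trans (hit_set_pi A g1) _.
rewrite (_ : [set _ | _] = [set` s]) //; apply/seteqP.
by split => z zZ; have [h1 h2] := sZ z Logic.I; [exact: h1|exact: h2].
Qed.

End HitSets.

(** * Contraction of the horospherical group by the dilations *)

Lemma dilationE (R : realType) (k m : nat) (L : R) p q : dilation k m L p q =
  (if (p < k)%N then L `^ (- (m.+1%:R / k%:R)) else L) *+ (p == q).
Proof.
rewrite /dilation; case: (split_ordP p) => p' ->; case: (split_ordP q) => q' ->;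
  rewrite ?(block_mxEul, block_mxEur, block_mxEdl, block_mxEdr) !mxE !eq_shift //=;
  by rewrite ?ltn_ord // ltnNge leq_addr.
Qed.

Lemma elem_mul_dilation (R : realType) (k m : nat) (L : R) (i j : 'I_(k + m.+1)) s :
  L != 0 -> (k <= i)%N -> (j < k)%N ->
  elem i j s *m dilation k m L =
  dilation k m L *m elem i j (s * (L `^ (- (m.+1%:R / k%:R)) / L)).
Proof.
move=> L0 ki jk; rewrite /elem mulmxDl mulmxDr mul1mx mulmx1; congr (_ + _).
rewrite -scalemxAl -scalemxAr; apply/matrixP => p q; rewrite mxE [RHS]mxE -mulrA.
congr (_ * _).
have -> : (delta_mx i j *m dilation k m L) p q = (p == i)%:R * dilation k m L j q.
  rewrite mxE (bigD1 j) //= big1 ?addr0 => [|l lj]; first by rewrite mxE eqxx andbT.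
  by rewrite mxE (negbTE lj) andbF mul0r.
have -> : (dilation k m L *m delta_mx i j) p q = dilation k m L p i * (q == j)%:R.
  rewrite mxE (bigD1 i) //= big1 ?addr0 => [|l li]; first by rewrite [delta_mx i j i q]mxE eqxx.
  by rewrite [delta_mx i j l q]mxE (negbTE li) mulr0.
rewrite !dilationE jk.
have [->|pi] := eqVneq p i; last by rewrite mul0r mulr0n mul0r mulr0.
rewrite ltnNge ki /= mul1r mulr1n eq_sym mulrA divfK //.
by case: (q == j); rewrite ?mulr1 ?mulr0.
Qed.

(* At rate [L^(-n/k)], the hypothesis of [mixing] for the horospherical group [U(s)]. *)
Lemma contract_dilation (R : realType) (k m : nat) (u : nat -> R) (i j : 'I_(k + m.+1))
    (s : R) :
  (0 < k)%N -> u @ \oo --> +oo -> (k <= i)%N -> (j < k)%N ->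
  mxcvg \oo (fun n => \adj (dilation k m (u n)) *m elem i j s *m dilation k m (u n)) 1%:M.
Proof.
move=> k0 u_oo ki jk p q.
pose t n := u n `^ (- (m.+1%:R / k%:R)) / u n.
have u1 : \forall n \near \oo, 1 <= u n by exact: (cvgryPge _).1.
have t0 : t @ \oo --> (0 : R).
  (* The crude bound [t n <= 1 / u n], valid once [u n >= 1], is enough. *)
  have v0 : (fun n => (u n)^-1) @ \oo --> (0 : R).
    apply/gtr0_cvgV0 => //; near=> n.
    by apply: (@lt_le_trans _ _ 1) => //; near: n.
  apply: (squeeze_cvgr _ (cvg_cst (0 : R)) v0).
  apply: filterS u1 => n un; have un0 : 0 < u n by exact: lt_le_trans un.
  have v1 : 0 <= (u n)^-1 by rewrite invr_ge0 ltW.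
  rewrite /t mulr_ge0 ?powR_ge0 //=; apply: ler_piMl => //.
  rewrite -[leRHS](powRr0 (u n)); apply: ler_powR => //.
have near_e : {near \oo, (fun n => (1%:M : 'M[R]_(k + m.+1)) p q +
     s * t n * (delta_mx i j : 'M[R]_(k + m.+1)) p q) =1
   (fun n => (\adj (dilation k m (u n)) *m elem i j s *m dilation k m (u n)) p q)}.
  apply: filterS u1 => n un; have un0 : 0 < u n by exact: lt_le_trans un.
  rewrite -mulmxA elem_mul_dilation ?gt_eqF // mulmxA mul_adj1 ?det_dilation // mul1mx.
  by rewrite !mxE.
apply: cvg_trans (near_eq_cvg near_e) _.
have : (fun n => (1%:M : 'M[R]_(k + m.+1)) p q + s * t n * (delta_mx i j : 'M[R]_(k + m.+1)) p q)
    @ \oo --> (1%:M : 'M[R]_(k + m.+1)) p q + s * 0 * (delta_mx i j : 'M[R]_(k + m.+1)) p q.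
  by apply: cvgD; [exact: cvg_cst|apply: cvgMl; exact: cvgMr].
by rewrite mulr0 mul0r addr0.
Unshelve. all: by end_near. Qed.

Theorem theorem2 (R : realType) (k m : nat) (hk : (0 < k)%N)
  (W : set 'rV[R]_(m.+1))
  (hWborel : borel_mx W)
  (hWbounded : exists M : R, forall w, W w -> `|w| <= M)
  (hWpos : forall w, W w -> 0 < w ord0 ord_max)
  (hWint : interior W !=set0)
  (hWbd : lebesgue_null (closure W `\` interior W))
  (mu : probability (X R (k + m.+1)) R)
  (hmu : right_SL_invariant mu)
  (lam : probability (X R (k + m.+1)) R)
  (hlam : lam `<< mu)
  (r : nat) (A : 'I_r -> set 'rV[R]_k)
  (hA : forall i, borel_mx (A i))
  (N : 'I_r -> nat) :
  (fun L : R => lam [set x : X R (k + m.+1) | forall i : 'I_r,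
       (hit_set W x L (L `^ (- ((k + m.+1)%:R / k%:R))) (A i) #= `I_(N i))%card])
    @ +oo%R -->
  mu [set x : X R (k + m.+1) | forall i : 'I_r,
       (hit_set W x 1 1 (A i) #= `I_(N i))%card].
Proof.
set E := [set x | forall i, (hit_set W x 1 1 (A i) #= _)%card].
have mE : measurable E.
  rewrite (_ : E = \bigcap_(i in [set: 'I_r])
      [set x : X R (k + m.+1) | (hit_set W x 1 1 (A i) #= `I_(N i))%card]).
    by apply: fin_bigcap_measurable => // i _; exact: measurable_hit.
  by apply/seteqP; split => x h i => [_|]; exact: h.
have EL L : 0 < L -> [set x : X R (k + m.+1) | forall i : 'I_r,
     (hit_set W x L (L `^ (- ((k + m.+1)%:R / k%:R))) (A i) #= `I_(N i))%card] =
     act (dilation k m L) @^-1` E.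
  move=> L0; apply/seteqP; split => x h i; have hD := hit_set_dilation W x (A i) hk L0.
    exact: card_eq_trans (card_esym hD) (h i).
  exact: card_eq_trans hD (h i).
have mact L : 0 < L -> measurable (act (dilation k m L) @^-1` E).
  by move=> L0; apply: measurable_act => //; exact: det_dilation.
rewrite (prE mu mE).
have near_pr : {near +oo%R, (fun L : R => (pr lam (act (dilation k m L) @^-1` E))%:E) =1
    (fun L : R => lam [set x : X R (k + m.+1) | forall i : 'I_r,
       (hit_set W x L (L `^ (- ((k + m.+1)%:R / k%:R))) (A i) #= `I_(N i))%card])}.
  near=> L; have L0 : 0 < L by near: L; exact: nbhs_pinfty_gt.
  by rewrite EL // prE //; exact: mact.
apply: cvg_trans (near_eq_cvg near_pr) _.
apply: cvg_EFin; first exact: nearW.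
(* Mixing is stated along sequences; a limit at infinity over the reals is tested on sequences
   tending to infinity. *)
apply/cvg_pinftyP => u u_oo.
have u0 : \forall n \near \oo, 0 < u n by exact: (cvgryPgt _).1.
(* Mixing asks for determinant 1 at every index, and [u n] may fail to be positive at finitely many;
   the identity fills in there. *)
pose a n := if 0 < u n then dilation k m (u n) else 1%:M.
have a1 n : \det (a n) = 1.
  by rewrite /a; case: ifP => un; [exact: det_dilation|exact: det1].
have near_a : {near \oo, (fun n => pr lam (act (a n) @^-1` E)) =1
    (fun n => pr lam (act (dilation k m (u n)) @^-1` E))}.
  by apply: filterS u0 => n un; rewrite /a un.
apply: cvg_trans (near_eq_cvg near_a) _.
apply: (mixing_dominated hlam).
- by move=> n; exact: measurable_act.
- by rewrite pr_ge0 pr_le1.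
(* Rows [i >= k] and columns [j < k] are the root subgroups that make up the group of the [U(s)]
   together with its analogues for the middle block. *)
move=> B mB; apply: (mixing hmu a1 (I := fun i => (k <= i)%N)) => //.
- by exists (rshift k ord0) => /=; exact: leq_addr.
- by exists (lshift m.+1 (Ordinal hk)); rewrite -ltnNge /=.
move=> i j s /= ki; rewrite -ltnNge => jk.
have := contract_dilation s hk u_oo ki jk.
move=> c p q; apply: cvg_trans (c p q); apply: near_eq_cvg.
by apply: filterS u0 => n un; rewrite /a un.
Unshelve. all: by end_near. Qed.
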